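(* Fix a dimension $d\ge2$ and one of the types A, B, D below. For each $n$ (large enough to satisfy the size condition of that type) let $(\xi_1,\dots,\xi_n)$ be a tuple of random vectors in $\mathbb{R}^d$ satisfying all assumptions of that type, with associated convex hull $H_{n,d}$. Then as $n\to\infty$, $$\mathbb{P}[0\notin H_{n,d}]\sim\frac{2(\log n)^{d-1}}{(d-1)!\,n}\ \text{ in type A},\qquad \mathbb{P}[0\notin H_{n,d}]\sim\frac{(\log n)^{d-1}}{2^{d-2}(d-1)!\sqrt{\pi n}}\ \text{ in types B and D}.$$
   Context: $x_n\sim y_n$ means $x_n/y_n\to1$. For a tuple $(\xi_1,\dots,\xi_n)$ of random vectors in $\mathbb{R}^d$, put $S_k=\xi_1+\dots+\xi_k$ and $S_n^*=S_{n-1}-\xi_n$. Type A: $n\ge d+1$; the tuple is exchangeable ($(\xi_1,\dots,\xi_n)\stackrel{d}{=}(\xi_{\sigma(1)},\dots,\xi_{\sigma(n)})$ for all permutations $\sigma$); $S_n=0$ a.s.; any $d$ vectors among $S_1,\dots,S_{n-1}$ are linearly independent a.s.; $H_{n,d}=\mathrm{Conv}(S_1,\dots,S_{n-1})$. Type B: $n\ge d$; $(\xi_1,\dots,\xi_n)\stackrel{d}{=}(\varepsilon_1\xi_{\sigma(1)},\dots,\varepsilon_n\xi_{\sigma(n)})$ for all permutations $\sigma$ and all signs $\varepsilon_i\in\{-1,1\}$; any $d$ vectors among $S_1,\dots,S_n$ are linearly independent a.s.; $H_{n,d}=\mathrm{Conv}(S_1,\dots,S_n)$. Type D: $n\ge\max\{2,d\}$;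 the same invariance as type B but only for signs with $\varepsilon_1\cdots\varepsilon_n=1$; any $d$ vectors from either collection $S_1,\dots,S_n$ or $S_1,\dots,S_{n-1},S_n^*$ are linearly independent a.s.; $H_{n,d}=\mathrm{Conv}(S_1,\dots,S_n,S_n^* )$. *)

(* Defs.v *)
From HB Require Import structures.
From mathcomp Require Import all_boot all_order all_fingroup all_algebra.
From mathcomp Require Import all_classical all_reals all_analysis.
Set Implicit Arguments. Unset Strict Implicit. Unset Printing Implicit Defensive.
Import Order.TTheory GRing.Theory Num.Theory.
Local Open Scope classical_set_scope.
Local Open Scope ring_scope.

Inductive ctype := TypeA | TypeB | TypeD.

Section Defs.
Variable R : realType.

(* Borel sigma-algebra on m x k real matrices (= product of Borel sigma-algebras
   of the coordinates): generated by the coordinate cylinders. *)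
Definition mx_cyl (m k : nat) : set (set 'M[R]_(m, k)) :=
  [set B | exists (i : 'I_m) (j : 'I_k) (A : set R),
           measurable A /\ B = [set M : 'M[R]_(m, k) | A (M i j)]].
Definition mx_borel (m k : nat) : set (set 'M[R]_(m, k)) := <<s (@mx_cyl m k) >>.

Context (dsp : measure_display) (T : measurableType dsp).

Definition rand_mx (m k : nat) (X : T -> 'M[R]_(m, k)) :=
  forall B, mx_borel B -> measurable (X @^-1` B).

Definition same_law (P : probability T R) (m k : nat) (X Y : T -> 'M[R]_(m, k)) :=
  forall B, mx_borel B -> P (X @^-1` B) = P (Y @^-1` B).

Variables (n d : nat) (xi : 'I_n -> T -> 'rV[R]_d).

(* the tuple (xi_1, ..., xi_n) as an n x d matrix (row i = xi_{i+1}) *)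
Definition tup (w : T) : 'M[R]_(n, d) := \matrix_(i, j) xi i w 0 j.

Definition tup_ps (s : 'S_n) (e : 'I_n -> bool) (w : T) : 'M[R]_(n, d) :=
  \matrix_(i, j) ((-1) ^+ e i * xi (s i) w 0 j).

Definition Ssum (k : nat) (w : T) : 'rV[R]_d := \sum_(i < n | (i < k)%N) xi i w.

Definition Sstar (w : T) : 'rV[R]_d :=
  Ssum n.-1 w - \sum_(i < n | (nat_of_ord i == n.-1)%N) xi i w.

Definition any_d_indep (m : nat) (v : 'I_m -> 'rV[R]_d) : Prop :=
  forall f : 'I_d -> 'I_m, injective f -> row_free (\matrix_(k < d) v (f k)).

Definition zero_in_conv (m : nat) (v : 'I_m -> 'rV[R]_d) : Prop :=
  exists lam : 'I_m -> R, (forall i, 0 <= lam i) /\ \sum_i lam i = 1 /\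
                          \sum_i lam i *: v i = 0.

Definition famA (w : T) : 'I_n.-1 -> 'rV[R]_d := fun i => Ssum i.+1 w.
Definition famB (w : T) : 'I_n -> 'rV[R]_d := fun i => Ssum i.+1 w.
Definition famD (w : T) : 'I_n.+1 -> 'rV[R]_d :=
  fun i => if (i < n)%N then Ssum i.+1 w else Sstar w.
Definition famDstar (w : T) : 'I_n -> 'rV[R]_d :=
  fun i => if (i < n.-1)%N then Ssum i.+1 w else Sstar w.

Variable P : probability T R.

Definition hypA : Prop :=
  [/\ (forall i, rand_mx (xi i)),
      (forall s : 'S_n, same_law P tup (tup_ps s (fun _ => false))),
      {ae P, forall w, Ssum n w = 0}
    & {ae P, forall w, any_d_indep (famA w)}].

Definition hypB : Prop :=
  [/\ (forall i, rand_mx (xi i)),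
      (forall (s : 'S_n) (e : 'I_n -> bool), same_law P tup (tup_ps s e))
    & {ae P, forall w, any_d_indep (famB w)}].

Definition hypD : Prop :=
  [/\ (forall i, rand_mx (xi i)),
      (forall (s : 'S_n) (e : 'I_n -> bool),
          \prod_(i < n) ((-1) ^+ e i : R) = 1 -> same_law P tup (tup_ps s e)),
      {ae P, forall w, any_d_indep (famB w)}
    & {ae P, forall w, any_d_indep (famDstar w)}].

Definition hyps (t : ctype) : Prop :=
  match t with TypeA => hypA | TypeB => hypB | TypeD => hypD end.

Definition not_in_hull (t : ctype) : set T :=
  match t with
  | TypeA => [set w | ~ zero_in_conv (famA w)]
  | TypeB => [set w | ~ zero_in_conv (famB w)]
  | TypeD => [set w | ~ zero_in_conv (famD w)]
  end.

End Defs.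

Definition size_ok (t : ctype) (d n : nat) : bool :=
  match t with
  | TypeA => (d.+1 <= n)%N
  | TypeB => (d <= n)%N
  | TypeD => (maxn 2 d <= n)%N
  end.

Definition rate (R : realType) (t : ctype) (d n : nat) : R :=
  match t with
  | TypeA => 2 * ln (n%:R) ^+ d.-1 / ((d.-1)`!%:R * n%:R)
  | _ => ln (n%:R) ^+ d.-1 /
           (2 ^+ (d - 2) * (d.-1)`!%:R * Num.sqrt (pi * n%:R))
  end.

(* Main.v *)
(** A signed permutation g of the steps puts 0 in the convex hull of the partial
   sums iff the kernel M of l |-> sum_i l_i xi_i meets the Weyl chamber of g.
   Inserting the last step cuts each chamber by hyperplanes that are linearly
   ordered on it, so the number of pieces met by M exceeds the number of walls
   met by one.  This gives c(n, d) = c(n - 1, d - 1) + s(n - 1) c(n - 1, d) for the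
   number c(n, d) of chambers met (s(m) = m in type A, 2m + 1 in type B), whatever
   the steps in general position.  Averaging over the group yields the exact
   probability; type D follows from type B since P_D(n) = 2 P_B(n) - P_B(n - 1).
   Stolz-Cesaro and Wallis turn the recurrence into the asymptotics. *)
Require Import Defs.
From HB Require Import structures.
From mathcomp Require Import all_boot all_order all_fingroup all_algebra.
From mathcomp Require Import all_classical all_reals all_analysis.
From mathcomp Require Import measurable_realfun.
From mathcomp Require Import zify ring lra.
Set Implicit Arguments. Unset Strict Implicit. Unset Printing Implicit Defensive.
Import Order.TTheory GRing.Theory Num.Theory numFieldNormedType.Exports.
Local Open Scope classical_set_scope.
Local Open Scope ring_scope.

(** The induction concerns chambers that meet a subspace W of codimension d; the theorem uses W = 0.
    If c is the coefficient of the inserted step x, the walls in l_1 > ... > l_m are c = l_i, and in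
    type B also c = - l_i and c = 0. On a wall x is merged into a step a, which becomes a + x or a -
    x, or x is dropped; so a wall is again a chamber, for a tuple without x. Summed over the group,
    the walls are exactly the chambers of the s(n - 1) merged tuples of n - 1 steps, whence the
    second term of the recurrence. Leaving c free replaces W by W + <x>, of codimension d - 1,
    whence the first term. The obstacle is that general position has to survive both reductions and
    has to make every wall transversal. It is therefore stated for partial sums and relative to W:
    merging only deletes a partial sum, and a first step x only shifts the other sums by x. The
    factor 2 of the asymptotics is the reciprocal of the probability-like weight w = 1/2 at the
    shortest walk in dimension 1, where 0 is never in the hull. In type D the laws of the two walks
    are not known separately; only the sum of their probabilities is computed. *)

Section Insertion.
Variables (T : Type) (b : bool) (neg : T -> T).

(** [b] selects the reflection group: permutations if false, signed permutations if true. [neg] is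
    abstract so that the same enumeration serves vectors and symbolic codes. *)
Fixpoint ins (x : T) (y : seq T) : seq (seq T) :=
  (x :: y) :: (if b then [:: neg x :: y] else [::]) ++
  (if y is a :: y' then map (cons a) (ins x y') else [::]).

Fixpoint sp (s : seq T) : seq (seq T) :=
  if s is x :: s' then flatten [seq ins x y | y <- sp s'] else [:: [::]].

(** The number of walls that the coefficient of an inserted step can cross, one less than the number
    of insertions. *)
Definition slots m := (if b then m.*2.+1 else m)%N.

End Insertion.

(** The order of the group: n! without signs, 2^n n! with signs. *)
Fixpoint sp_total b n := (if n is m.+1 then (slots b m).+1 * sp_total b m else 1)%N.

Section InsertionTheory.
Variables (T : Type) (b : bool) (neg : T -> T).
Local Notation ins := (ins b neg).
Local Notation sp := (sp b neg).

Lemma sum_ins_nil x (F : seq T -> nat) :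
  (\sum_(z <- ins x [::]) F z = F [:: x] + b * F [:: neg x])%N.
Proof. by case: b; rewrite /= !big_cons big_nil ?mul1n ?mul0n !addn0. Qed.

Lemma sum_ins_cons x a y (F : seq T -> nat) :
  (\sum_(z <- ins x (a :: y)) F z =
   F [:: x, a & y] + b * F [:: neg x, a & y] + \sum_(z <- ins x y) F (a :: z))%N.
Proof.
rewrite -[ins x (a :: y)]/([:: [:: x, a & y]] ++ (if b then [:: [:: neg x, a & y]] else [::]) ++ map (cons a) (ins x y)).
by rewrite !big_cat big_seq1 big_map; case: b;
  rewrite /= ?big_seq1 ?big_nil ?mul1n ?mul0n ?addnA.
Qed.

Lemma sum_sp_cons x s (F : seq T -> nat) :
  (\sum_(z <- sp (x :: s)) F z = \sum_(y <- sp s) \sum_(z <- ins x y) F z)%N.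
Proof. by rewrite /= big_flatten big_map. Qed.

Lemma size_ins x y : size (ins x y) = (slots b (size y)).+1.
Proof.
rewrite /slots; elim: y => [|a y IH] /=; first by case: b.
by rewrite size_cat size_map IH; case: b {IH}.
Qed.

End InsertionTheory.

Lemma map_ins (T U : Type) b (neg : T -> T) (neg' : U -> U) (f : T -> U)
  (fN : forall x, f (neg x) = neg' (f x)) x y :
  map (map f) (ins b neg x y) = ins b neg' (f x) (map f y).
Proof.
elim: y => [|a y IH] /=; first by case: b; rewrite /= ?fN.
by rewrite map_cat -map_comp -IH -map_comp; case: b {IH}; rewrite /= ?fN.
Qed.

Lemma map_sp (T U : Type) b (neg : T -> T) (neg' : U -> U) (f : T -> U)
  (fN : forall x, f (neg x) = neg' (f x)) s :
  map (map f) (sp b neg s) = sp b neg' (map f s).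
Proof.
elim: s => //= x s IH; rewrite map_flatten -IH -!map_comp; congr flatten.
by apply: eq_map => y /=; apply: map_ins.
Qed.

Lemma ins_size (T : eqType) b (neg : T -> T) x y z :
  z \in ins b neg x y -> size z = (size y).+1.
Proof.
elim: y z => [|a y IH] z /=.
  by case: b; rewrite !inE; [case/orP|]; move=> /eqP ->.
rewrite !inE mem_cat; case/or3P => [/eqP -> //||/mapP [z' /IH e ->] /=]; last by rewrite e.
by case: b {IH} => //; rewrite inE => /eqP ->.
Qed.

Lemma sp_size (T : eqType) b (neg : T -> T) s y : y \in sp b neg s -> size y = size s.
Proof.
elim: s y => [|x s IH] y /=; first by rewrite inE => /eqP ->.
by case/flattenP => l /mapP [z /IH e ->] /ins_size ->; rewrite e.
Qed.

Lemma size_sp (T : eqType) b (neg : T -> T) s : size (sp b neg s) = sp_total b (size s).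
Proof.
elim: s => //= x s IH; rewrite size_flatten /shape -map_comp -IH sumnE big_map.
rewrite (eq_big_seq (fun => (slots b (size s)).+1)) => [|y /sp_size <- /=]; last exact: size_ins.
by rewrite big_const_seq count_predT iter_addn_0.
Qed.

(** The walls between neighbouring insertions of x into y. Where the coefficient of x is plus or
    minus that of a, x is absorbed into a; the base case for signs is the wall of coefficient 0, on
    which x disappears and y is left intact. *)
Fixpoint mg (V : zmodType) (b : bool) (x : V) (y : seq V) : seq (seq V) :=
  if y is a :: y' then
    ((a + x) :: y') :: (if b then [:: (a - x) :: y'] else [::]) ++ map (cons a) (mg b x y')
  else if b then [:: [::]] else [::].

(** * Merging a step commutes with enumerating signed permutations *)

Section Merging.
Variables (V : zmodType) (b : bool).
Local Notation ins := (@ins V b -%R).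
Local Notation sp := (@sp V b -%R).
Local Notation mg := (@mg V b).

Lemma sum_mg_cons x a y (F : seq V -> nat) :
  (\sum_(z <- mg x (a :: y)) F z =
   F ((a + x)%R :: y) + b * F ((a - x)%R :: y) + \sum_(z <- mg x y) F (a :: z))%N.
Proof.
rewrite /= big_cons big_cat big_map addnA; congr (_ + _ + _)%N.
by case: b; rewrite ?big_seq1 ?big_nil ?mul1n ?mul0n.
Qed.

Lemma sum_mg_nil x (F : seq V -> nat) : (\sum_(z <- mg x [::]) F z = b * F [::])%N.
Proof. by rewrite /=; case: b; rewrite ?big_seq1 ?big_nil ?mul1n ?mul0n. Qed.

Lemma size_mg x y : size (mg x y) = slots b (size y).
Proof.
rewrite /slots; elim: y => [|a y IH] /=; first by case: b.
by rewrite size_cat size_map IH; case: b {IH}.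
Qed.

Lemma mg_size x y z : z \in mg x y -> size z = size y.
Proof.
elim: y z => [|a y IH] z /=; first by case: b; rewrite ?inE // => /eqP ->.
rewrite !inE mem_cat; case/or3P => [/eqP -> //||/mapP [z' /IH e ->] /=]; last by rewrite e.
by case: b {IH} => //; rewrite inE => /eqP ->.
Qed.

(* Merging x into the freshly inserted +-a gives an insertion of +-(a + x) or
   +-(a - x); merging it elsewhere commutes with the insertion. *)
Lemma sum_ins_mg a x y (f : seq V -> nat) :
  (\sum_(z <- ins a y) \sum_(w <- mg x z) f w =
   \sum_(w <- ins (a + x)%R y) f w + b * \sum_(w <- ins (a - x)%R y) f w +
   \sum_(z <- mg x y) \sum_(w <- ins a z) f w)%N.
Proof.
elim: y f => [|c y IH] f.
  rewrite !sum_ins_nil !sum_mg_cons !sum_mg_nil !sum_ins_nil.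
  case: b; rewrite ?mul0n ?mul1n ?opprB ?opprD ?opprK ?(addrC x (- a)) /=; ring.
rewrite !sum_ins_cons !sum_mg_cons !sum_ins_cons.
rewrite (eq_bigr _ (fun z _ => sum_mg_cons x c z f)).
rewrite (eq_bigr _ (fun z _ => sum_ins_cons b -%R a c z f)).
rewrite !big_split -!big_distrr /= (IH (fun w => f (c :: w))).
by case: b {IH}; rewrite ?mul0n ?mul1n ?opprB ?opprD ?opprK ?(addrC x (- a)) /=; ring.
Qed.

(** The walls of all chambers are regrouped by merged tuple, which makes the induction hypothesis
    applicable to them. Quantifying over [f] expresses equality of multisets. *)
Lemma sum_sp_mg x s (f : seq V -> nat) :
  (\sum_(y <- sp s) \sum_(w <- mg x y) f w = \sum_(s' <- mg x s) \sum_(w <- sp s') f w)%N.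
Proof.
elim: s f => [|a s IH] f; first by rewrite sum_mg_nil /= !big_seq1 sum_mg_nil.
rewrite sum_sp_cons (eq_bigr _ (fun y _ => sum_ins_mg a x y f)) sum_mg_cons !sum_sp_cons.
rewrite !big_split -!big_distrr /= (IH (fun z => \sum_(w <- ins a z) f w)%N).
by congr (_ + _ + _)%N; apply: eq_bigr => s' _; rewrite sum_sp_cons.
Qed.

(** Read off from the multiset identity with [f] the indicator of w: a sum of naturals is positive
    iff one of its terms is. *)
Lemma mem_sp_mg x s s' w : s' \in mg x s -> w \in sp s' -> exists2 y, y \in sp s & w \in mg x y.
Proof.
move=> s's ws'.
have mem_sum (l : seq (seq V)) (g : seq V -> nat) z : z \in l -> (0 < g z -> 0 < \sum_(i <- l) g i)%N.
  by move=> zl gz; rewrite (big_rem z) //= ltn_addr.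
have sum_mem (l : seq (seq V)) (g : seq V -> nat) : (0 < \sum_(i <- l) g i)%N -> exists2 z, z \in l & (0 < g z)%N.
  move=> h; apply: contrapT => nex; move: h; rewrite big_seq big1 // => z zl.
  by apply/eqP; rewrite -leqn0 leqNgt; apply/negP => gz; apply: nex; exists z.
have : (0 < \sum_(s' <- mg x s) \sum_(w' <- sp s') (w' == w))%N.
  by apply: (mem_sum _ _ s') => //; apply: (mem_sum _ _ w) => //; rewrite eqxx.
rewrite -(sum_sp_mg x s (fun w' => (w' == w)%N)) => /sum_mem [y ys /sum_mem [w' w'y]].
by rewrite lt0b => /eqP e; exists y; rewrite // -e.
Qed.

End Merging.

(** * Open convex cones cut by a hyperplane *)

Section OpenCones.
Variable R : realFieldType.

(** [oconeP] is openness without a topology: a large multiple of a point absorbs any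
    displacement. *)
Record open_cone (O : (nat -> R) -> Prop) : Prop := OpenCone {
  oconeD : forall u v, O u -> O v -> O (fun i => u i + v i);
  oconeZ : forall a u, 0 < a -> O u -> O (fun i => a * u i);
  oconeP : forall u v, O u -> exists2 a, 0 < a & O (fun i => a * u i + v i) }.

Definition linear_form (h : (nat -> R) -> R) :=
  forall a u v, h (fun i => a * u i + v i) = a * h u + h v.

Lemma linear_form_coef c i d j : linear_form (fun u => c * u i + d * u j).
Proof. by move=> a u v; ring. Qed.

Lemma linear_formZ h : linear_form h -> forall a u, h (fun i => a * u i) = a * h u.
Proof.
move=> hl a u; have h0 : h (fun i => 0) = 0.
  have := hl 1 (fun i => 0) (fun i => 0).
  have -> : (fun i : nat => 1 * 0 + 0 : R) = fun=> 0 by apply/funext => i; rewrite mul1r addr0.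
  lra.
have := hl a u (fun=> 0); rewrite h0 addr0 => <-; congr h; apply/funext => i; exact/esym/addr0.
Qed.

Lemma linear_formD h : linear_form h -> forall u v, h (fun i => u i + v i) = h u + h v.
Proof.
move=> hl u v; have := hl 1 u v; rewrite mul1r => <-.
by congr h; apply/funext => i; rewrite mul1r.
Qed.

Lemma open_cone_true : open_cone (fun=> true).
Proof. by split=> // u v _; exists 1. Qed.

Lemma open_cone_lt h : linear_form h -> open_cone (fun u => 0 < h u).
Proof.
move=> hl; split=> [u v hu hv|a u a0 hu|u v hu].
- by rewrite linear_formD // addr_gt0.
- by rewrite linear_formZ // mulr_gt0.
- exists ((1 + `|h v|) / h u); first by rewrite divr_gt0 // ltr_pwDl.
  rewrite hl mulfVK ?gt_eqF //; have := ler_norm (- h v); rewrite normrN; lra.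
Qed.

Lemma open_coneI O1 O2 : open_cone O1 -> open_cone O2 -> open_cone (fun u => O1 u /\ O2 u).
Proof.
move=> [D1 Z1 P1] [D2 Z2 P2]; split=> [u v [u1 u2] [v1 v2]|a u a0 [u1 u2]|u v [u1 u2]].
- by split; [apply: D1|apply: D2].
- by split; [apply: Z1|apply: Z2].
- have [a a0 ha] := P1 u v u1; have [c c0 hc] := P2 u v u2.
  exists (a + c); first exact: addr_gt0.
  split.
    have -> : (fun i => (a + c) * u i + v i) = fun i => c * u i + (a * u i + v i).
      by apply/funext => i; ring.
    by apply: D1 ha; apply: Z1.
  have -> : (fun i => (a + c) * u i + v i) = fun i => a * u i + (c * u i + v i).
    by apply/funext => i; ring.
  by apply: D2 hc; apply: Z2.
Qed.

Lemma open_cone_all (I : Type) (r : seq I) (p : I -> (nat -> R) -> bool) :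
  (forall i, open_cone (p i)) -> open_cone (fun u => all (p ^~ u) r).
Proof.
move=> po; elim: r => [|i r IH] /=; first exact: open_cone_true.
rewrite (_ : (fun u => _) = (fun u => p i u /\ all (p ^~ u) r)); first exact: open_coneI.
by apply/funext => u; apply/propext; split=> [/andP[]|[? ?]] //; apply/andP.
Qed.

Lemma open_cone_pairwise (r : seq nat) :
  open_cone (fun u => pairwise (fun i j => u j < u i) r).
Proof.
elim: r => [|i r IH] /=; first exact: open_cone_true.
rewrite (_ : (fun u => _) = (fun u => all (fun j => u j < u i) r /\
    pairwise (fun i j => u j < u i) r)); last first.
  by apply/funext => u; apply/propext; split=> [/andP[]|[? ?]] //; apply/andP.
apply: open_coneI => //.
apply: (open_cone_all _ (p := fun j u => u j < u i)) => j.
rewrite (_ : (fun u => _) = (fun u => is_true (0 < 1 * u i + -1 * u j))).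
  exact/open_cone_lt/linear_form_coef.
by apply/funext => u; rewrite mul1r mulN1r subr_gt0.
Qed.

Lemma open_cone_imply (b : bool) (p : (nat -> R) -> bool) :
  open_cone p -> open_cone (fun u => b ==> p u).
Proof. by case: b => //= _; exact: open_cone_true. Qed.

Variable V : vectType R.

(* A convex relatively open cone cut by a hyperplane h = 0 not containing its
   span loses nothing if it misses the hyperplane, and splits in two otherwise. *)
Lemma split_open_cone (O : (nat -> R) -> Prop) (h : (nat -> R) -> R)
    (L : (nat -> R) -> V) (W : {vspace V}) (dlt : nat -> R) :
  open_cone O -> linear_form h ->
  (forall a u v, L (fun i => a * u i + v i) = a *: L u + L v) ->
  L dlt \in W -> h dlt = 1 ->
  (`[< exists u, [/\ O u, 0 < h u & L u \in W] >]%R +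
   `[< exists u, [/\ O u, h u < 0 & L u \in W] >]%R =
   `[< exists u, O u /\ L u \in W >]%R +
   `[< exists u, [/\ O u, h u = 0 & L u \in W] >]%R)%N.
Proof.
move=> Oo hl Ll Ld hd.
have LZ a u : L u \in W -> L (fun i => a * u i) \in W.
  move=> Lu; have -> : (fun i => a * u i) = (fun i => (a - 1) * u i + u i).
    by apply/funext => i; ring.
  by rewrite Ll memvD // memvZ.
have both : (exists u, [/\ O u, h u = 0 & L u \in W]) <->
  (exists u, [/\ O u, 0 < h u & L u \in W]) /\ (exists u, [/\ O u, h u < 0 & L u \in W]).
  split=> [[u [Ou hu Lu]]|[[u [Ou hu Lu]] [v [Ov hv Lv]]]].
    split.
      (* From a point of the wall, moving by [dlt] or its opposite reaches either side within the
         preimage of W. *)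
      have [a a0 Oa] := oconeP Oo dlt Ou; exists (fun i => a * u i + dlt i); split=> //.
        by rewrite hl hu hd; lra.
      by rewrite Ll memvD // memvZ.
    have [a a0 Oa] := oconeP Oo (fun i => -1 * dlt i) Ou.
    exists (fun i => a * u i + -1 * dlt i); split=> //.
      by rewrite hl hu (linear_formZ hl) hd; lra.
    by rewrite Ll memvD ?LZ // memvZ.
  (* Up to scaling, this is where the segment from u to v crosses h = 0. *)
  exists (fun i => - h v * u i + h u * v i); split.
  - by apply: (oconeD Oo); apply: (oconeZ Oo) => //; rewrite oppr_gt0.
  - by rewrite hl (linear_formZ hl); ring.
  - by rewrite Ll memvD ?LZ // memvZ.
have tri : (exists u, O u /\ L u \in W) <->
  (exists u, [/\ O u, 0 < h u & L u \in W]) \/ (exists u, [/\ O u, h u < 0 & L u \in W]).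
  split=> [[u [Ou Lu]]|[[u [Ou _ Lu]]|[u [Ou _ Lu]]]]; try by exists u.
  have [hu|hu|hu] := ltrgt0P (h u).
  - by left; exists u.
  - by right; exists u.
  - have /both[] : exists u, [/\ O u, h u = 0 & L u \in W] by exists u.
    by left.
have -> : `[< exists u, O u /\ L u \in W >] =
   `[< exists u, [/\ O u, 0 < h u & L u \in W] >] || `[< exists u, [/\ O u, h u < 0 & L u \in W] >].
  by rewrite -asbool_or; apply: asbool_equiv_eq.
have -> : `[< exists u, [/\ O u, h u = 0 & L u \in W] >] =
   `[< exists u, [/\ O u, 0 < h u & L u \in W] >] && `[< exists u, [/\ O u, h u < 0 & L u \in W] >].
  by rewrite -asbool_and; apply: asbool_equiv_eq.
by do 2 case: asboolP.
Qed.

End OpenCones.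

(** * Linear combinations of lists, and chambers met by a subspace *)

Section Positivity.
Variables (R : realFieldType) (V : vectType R).
Implicit Types (W : {vspace V}) (y z p : seq V) (x : V).

Fixpoint dot (l : seq R) (y : seq V) : V :=
  match l, y with c :: l', v :: y' => c *: v + dot l' y' | _, _ => 0 end.

Lemma dot_cat l1 l2 y1 y2 : size l1 = size y1 ->
  dot (l1 ++ l2) (y1 ++ y2) = dot l1 y1 + dot l2 y2.
Proof.
elim: l1 y1 => [|c l1 IH] [|v y1] //=; first by rewrite add0r.
by case=> /IH ->; rewrite addrA.
Qed.

Lemma dot_map_lin (L : seq nat) y a (u v : nat -> R) :
  dot (map (fun i => a * u i + v i) L) y = a *: dot (map u L) y + dot (map v L) y.
Proof.
elim: L y => [|i L IH] [|w y] /=; rewrite ?scaler0 ?addr0 //.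
by rewrite IH scalerDl scalerDr scalerA addrACA.
Qed.

Lemma dot_map_opp (L : seq nat) y (u : nat -> R) :
  dot (map (fun i => - u i) L) y = - dot (map u L) y.
Proof.
elim: L y => [|i L IH] [|w y] /=; rewrite ?oppr0 //.
by rewrite IH scaleNr opprD.
Qed.

Lemma span_dot (v : V) z : v \in <<z>>%VS -> exists2 l, size l = size z & v = dot l z.
Proof.
elim: z v => [|w z IH] v; first by rewrite span_nil memv0 => /eqP ->; exists [::].
rewrite span_cons => /memv_addP [u /vlineP [c ->] [u' /IH [l sl ->] ->]].
by exists (c :: l); rewrite /= ?sl.
Qed.

Lemma dot_span l z : dot l z \in <<z>>%VS.
Proof.
elim: l z => [|c l IH] [|w z] /=; rewrite ?mem0v //.
by rewrite span_cons memv_add ?memvZ ?memv_line.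
Qed.

(* For b = true (types B and D): W meets the image of the open Weyl chamber
   l_1 > ... > l_n > 0; for b = false (type A): of l_1 > ... > l_n. *)
Definition chamber_meets (b : bool) W z := exists l : seq R,
  [/\ size l = size z, pairwise >%R l, b ==> all (> 0) l & dot l z \in W].
Local Notation pos := chamber_meets.

Lemma map_nth_index (u0 : nat -> R) (l : seq R) (L : seq nat) :
  size l = size L -> uniq L -> map (fun i => if i \in L then nth 0 l (index i L) else u0 i) L = l.
Proof.
move=> sl uL; apply: (@eq_from_nth _ 0); rewrite size_map ?sl // => i iL.
by rewrite (nth_map 0%N) // mem_nth // index_uniq.
Qed.

(** Coefficients are addressed by labels rather than positions, so that insertions and mergings at
    different places can all be compared as conditions on one function u. *)
Lemma chamber_meets_lab b W z (L : seq nat) : size L = size z -> uniq L ->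
  pos b W z <-> exists u : nat -> R, [/\ pairwise (fun i j => u j < u i) L,
                 b ==> all (fun i => 0 < u i) L & dot (map u L) z \in W].
Proof.
move=> sL uL; split=> [[l [sl dl pl dW]]|[u [du pu dW]]].
  have sl' : size l = size L by rewrite sl.
  exists (fun i => if i \in L then nth 0 l (index i L) else 0).
  rewrite (map_nth_index _ sl') //; split => //.
    by rewrite -(@pairwise_map _ _ _ >%R) map_nth_index.
  by rewrite -(@all_map _ _ _ (> 0)) map_nth_index.
exists (map u L); rewrite size_map pairwise_map all_map; split=> //.
Qed.

End Positivity.

(** * The pieces and walls of one chamber *)

Section Slices.
Variables (R : realFieldType) (V : vectType R) (b : bool) (W : {vspace V}) (x : V).
Implicit Types (P Q : seq nat) (p y : seq V) (u : nat -> R).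
Local Notation pos := (chamber_meets b W).

Definition dec u (L : seq nat) := pairwise (fun i j => u j < u i) L && (b ==> all (fun i => 0 < u i) L).

(* Label 0 carries the coefficient of x. For b = true these are the coefficients
   l on p ++ y in the chamber together with c such that |c| < l_i for i in p; for
   b = false only c < l_i is required. *)
Definition slab P Q u : bool :=
  [&& dec u (P ++ Q), all (fun i => u 0%N < u i) P & b ==> all (fun i => - u 0%N < u i) P].

Definition total_vec P Q p y u := dot (map u P) p + dot (map u Q) y + u 0%N *: x.

Definition slab_meets P Q p y := exists u, slab P Q u /\ total_vec P Q p y u \in W.

Lemma open_cone_dec L : open_cone (dec ^~ L).
Proof.
rewrite (_ : (fun u : nat -> R => is_true _) = (fun u => pairwise (fun i j => u j < u i) L /\
   b ==> all (fun i => 0 < u i) L)); last first.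
  by apply/funext => u; apply/propext; split=> [/andP[]|[? ?]] //; apply/andP.
apply: open_coneI; first exact: open_cone_pairwise.
apply: open_cone_imply.
apply: (open_cone_all _ (p := fun i u => 0 < u i)) => i.
rewrite (_ : (fun u : nat -> R => is_true _) = (fun u => is_true (0 < 1 * u i + 0 * u i))).
  exact/open_cone_lt/linear_form_coef.
by apply/funext => u; rewrite mul1r mul0r addr0.
Qed.

Lemma open_cone_slab P Q : open_cone (slab P Q).
Proof.
rewrite (_ : (fun u : nat -> R => is_true _) = (fun u => dec u (P ++ Q) /\
   (all (fun i => u 0%N < u i) P /\ b ==> all (fun i => - u 0%N < u i) P))); last first.
  by apply/funext => u; apply/propext; split=> [/and3P[]|[? []? ?]] //; apply/and3P.
apply: open_coneI; first exact: open_cone_dec.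
apply: open_coneI.
  apply: (open_cone_all _ (p := fun i u => u 0%N < u i)) => i.
  rewrite (_ : (fun u : nat -> R => is_true _) = (fun u => is_true (0 < 1 * u i + -1 * u 0%N))).
    exact/open_cone_lt/linear_form_coef.
  by apply/funext => u; rewrite mul1r mulN1r subr_gt0.
apply: open_cone_imply.
apply: (open_cone_all _ (p := fun i u => - u 0%N < u i)) => i.
rewrite (_ : (fun u : nat -> R => is_true _) = (fun u => is_true (0 < 1 * u i + 1 * u 0%N))).
  exact/open_cone_lt/linear_form_coef.
by apply/funext => u; rewrite !mul1r -[u i + _]opprK opprD oppr_gt0 ltrBlDr add0r ltrNl.
Qed.

Lemma total_vec_lin P Q p y a u v :
  total_vec P Q p y (fun i => a * u i + v i) = a *: total_vec P Q p y u + total_vec P Q p y v.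
Proof.
rewrite /total_vec !dot_map_lin !scalerDr scalerDl scalerA.
rewrite (addrACA (a *: _) (dot _ _) (a *: _)).
by rewrite [LHS]addrACA.
Qed.

Definition upd u (c : R) : nat -> R := fun i => if i == 0%N then c else u i.

Lemma map_upd u c L : 0%N \notin L -> map (upd u c) L = map u L.
Proof.
move=> L0; apply/eq_in_map => i iL; rewrite /upd; case: eqP => // i0.
by rewrite -i0 iL in L0.
Qed.

Lemma dec_upd u c L : 0%N \notin L -> dec (upd u c) L = dec u L.
Proof.
have decE w : dec w L = pairwise >%R (map w L) && (b ==> all (> 0) (map w L)).
  by rewrite pairwise_map all_map.
by move=> L0; rewrite !decE map_upd.
Qed.

Lemma chamber_meets_dec z L : size L = size z -> uniq L ->
  pos z <-> exists u, dec u L /\ dot (map u L) z \in W.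
Proof.
move=> sL uL; rewrite (chamber_meets_lab b W sL uL); split=> -[u].
  by case=> h1 h2 h3; exists u; rewrite /dec h1.
by case=> /andP[h1 h2] h3; exists u.
Qed.

Lemma dec_cat u P Q : dec u (P ++ Q) =
  [&& allrel (fun i j => u j < u i) P Q, dec u P & dec u Q].
Proof.
rewrite /dec pairwise_cat all_cat.
by case: b => /=; rewrite ?andbT // -!andbA; do !bool_congr.
Qed.

Lemma dec_cons u i Q : dec u (i :: Q) =
  [&& all (fun j => u j < u i) Q, b ==> (0 < u i) & dec u Q].
Proof. by rewrite /dec /=; case: b => /=; rewrite ?andbT // -!andbA; do !bool_congr. Qed.

Section Events.
Variables (P Q : seq nat) (p y : seq V).
Hypotheses (sP : size P = size p) (sQ : size Q = size y).

(** The end of the list is the innermost slot. With signs, the bound [- u 0 < u i] of the slab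
    follows from positivity of both coefficients. *)
Lemma meets_last : uniq (0%N :: P) ->
  pos (p ++ [:: x]) <-> exists u, [/\ slab P [::] u, b ==> (0 < u 0%N) & total_vec P [::] p [::] u \in W].
Proof.
move=> /= /andP[P0 uP].
rewrite (chamber_meets_dec (L := P ++ [:: 0%N])); first last.
- by rewrite cat_uniq uP /= orbF P0.
- by rewrite !size_cat sP.
split=> -[u].
  rewrite dec_cat allrel1r dec_cons map_cat dot_cat ?size_map //= => -[/and3P[h1 h2 /andP[h3 _]] h4].
  exists u; split => //; last by rewrite /total_vec /= !addr0 in h4 *.
  rewrite /slab cats0 h2 h1 /=; apply/implyP => hb; move: h2; rewrite /dec hb /= => /andP[_ /allP h2].
  apply/allP => i iP; have := h2 i iP; move: h3; rewrite hb /=; lra.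
case=> /and3P[h1 h2 h3] h4 h5; exists u.
rewrite cats0 in h1.
rewrite dec_cat allrel1r dec_cons map_cat dot_cat ?size_map //= h1 h2 h4; split.
  by rewrite /dec /= implybT.
by rewrite /total_vec /= !addr0 in h5 *.
Qed.

Variables (q : nat) (c : V).
Hypothesis uPQ : uniq (0%N :: P ++ q :: Q).

Let P0 : 0%N \notin P.
Proof. by move: uPQ => /= /andP[]; rewrite mem_cat negb_or => /andP[]. Qed.
Let qQ0 : 0%N \notin q :: Q.
Proof. by move: uPQ => /= /andP[]; rewrite mem_cat negb_or => /andP[]. Qed.
Let q0 : (q == 0%N) = false.
Proof. by move: qQ0; rewrite inE negb_or eq_sym => /andP[/negbTE]. Qed.
Let PqQ0 : 0%N \notin P ++ q :: Q. Proof. by case/andP: uPQ. Qed.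
Let uPqQ : uniq (P ++ q :: Q). Proof. by case/andP: uPQ. Qed.
Let uP0qQ : uniq (P ++ [:: 0%N, q & Q]).
Proof. by rewrite -(uniq_catCA [:: 0%N]). Qed.

Lemma meets_before : pos (p ++ [:: x, c & y]) <->
  exists u, [/\ slab P (q :: Q) u, 0 < 1 * u 0%N + -1 * u q & total_vec P (q :: Q) p (c :: y) u \in W].
Proof.
rewrite (chamber_meets_dec (L := P ++ [:: 0%N, q & Q])) //; last by rewrite !size_cat sP /= sQ.
have eqL u : dot (map u (P ++ [:: 0%N, q & Q])) (p ++ [:: x, c & y]) = total_vec P (q :: Q) p (c :: y) u.
  by rewrite map_cat dot_cat ?size_map //= /total_vec /= addrAC -!addrA.
split=> -[u].
  rewrite eqL dec_cat allrel_consr dec_cons /= => -[/and3P[/andP[h1 h2] h3 /and3P[/andP[h4 h5] h6 h7]] hW].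
  exists u; split=> //; last by rewrite mul1r mulN1r subr_gt0.
  rewrite /slab dec_cat h1 h2 h3 h7 /=; apply/implyP => hb; move: h3; rewrite /dec hb /= => /andP[_ /allP h3].
  apply/allP => i iP; have := h3 i iP; move: h6; rewrite hb /=; lra.
case=> /and3P[h1 h2 h3]; rewrite mul1r mulN1r subr_gt0 => h4 hW; exists u; rewrite eqL; split=> //.
move: h1; rewrite dec_cat => /and3P[h5' hP h7]; rewrite dec_cat allrel_consr h5' hP h2 dec_cons h7.
move: h7; rewrite dec_cons => /and3P[h5 h6 _]; rewrite /= h4 /= andbT; apply/andP; split.
  by apply/allP => j /(allP h5) h; apply: lt_trans h4.
by move: h6; case: b => //= h6; apply: lt_trans h4.
Qed.

(** The chamber coordinate of - x is the opposite of the coefficient of x, whence the reflection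
    [upd u (- u 0)] in both directions. The conjunct [u 0 < u q] is carried along to match the
    second cut in [sum_chamber_ins]. *)
Lemma meets_before_opp : b -> pos (p ++ [:: - x, c & y]) <->
  exists u, [/\ slab P (q :: Q) u /\ 1 * u 0%N + -1 * u q < 0, 1 * u 0%N + 1 * u q < 0
              & total_vec P (q :: Q) p (c :: y) u \in W].
Proof.
move=> hb; rewrite (chamber_meets_dec (L := P ++ [:: 0%N, q & Q])) //; last by rewrite !size_cat sP /= sQ.
have eqL u : dot (map u (P ++ [:: 0%N, q & Q])) (p ++ [:: - x, c & y]) =
    total_vec P (q :: Q) p (c :: y) (upd u (- u 0%N)).
  rewrite map_cat dot_cat ?size_map // /total_vec !map_upd // /upd eqxx /=.
  by rewrite scalerN scaleNr addrAC -!addrA.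
split=> -[u].
  rewrite eqL dec_cat allrel_consr dec_cons /= => -[/and3P[/andP[h1 h2] h3 /and3P[/andP[h4 h5] h6 h7]] hW].
  have h8 : 0 < u q by move: h7; rewrite dec_cons hb /= => /and3P[].
  exists (upd u (- u 0%N)); rewrite {2 3 4 5}/upd eqxx q0; split=> //; last by lra.
  split; last by lra.
  rewrite /slab (dec_upd _ _ PqQ0).
  rewrite dec_cat h2 h3 h7 hb /= {1 3}/upd eqxx.
  move: h3; rewrite /dec hb /= => /andP[_ /allP h3].
  apply/andP; split; apply/allP => i iP; rewrite /upd; (case: eqP iP => [->|_ iP]; first by rewrite (negbTE P0)).
    have := h3 i iP; move: h6; rewrite hb /=; lra.
  by rewrite opprK; apply: (allP h1).
case=> -[/and3P[h1 h2 h3] h4] h5 hW; exists (upd u (- u 0%N)).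
have hq : 0 < u q by move: h1; rewrite dec_cat dec_cons hb /= => /and3P[_ _ /and3P[]].
rewrite eqL; split; last first.
  rewrite (_ : upd _ _ = u) //; apply/funext => i; rewrite /upd /=.
  by case: eqP => // ->; rewrite opprK.
move: h1; rewrite dec_cat dec_cons hb /= => /and3P[h6 h7 /and3P[h8 _ h9]].
have Q0 : 0%N \notin Q by move: qQ0; rewrite inE negb_or => /andP[].
rewrite dec_cat !dec_cons (dec_upd _ _ P0) (dec_upd _ _ Q0) allrel_consr hb h7 h9.
have eP i : i \in P -> upd u (- u 0%N) i = u i.
  by rewrite /upd; case: eqP => // -> iP; have := P0; rewrite iP.
have eQ i : i \in q :: Q -> upd u (- u 0%N) i = u i.
  by rewrite /upd; case: eqP => // -> iP; have := qQ0; rewrite iP.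
have e0 : upd u (- u 0%N) 0 = - u 0%N by rewrite /upd eqxx.
have eq' : upd u (- u 0%N) q = u q by rewrite eQ // mem_head.
rewrite e0 eq' hq /= andbT eq'; apply/and4P; split; last 1 first.
- by apply/allP => j jQ; rewrite eQ ?inE ?jQ ?orbT //; apply: (allP h8).
- apply/andP; split.
    by apply/allP => j jP; rewrite eP //; move: h3; rewrite hb /= => /allP; apply.
  by apply/allrelP => i j iP jQ; rewrite (eP _ iP) (eQ _ jQ); move/allrelP: h6; apply.
- apply/andP; split; first lra.
  apply/allP => j jQ; rewrite eQ ?inE ?jQ ?orbT //; have /= := allP h8 _ jQ; lra.
- by lra.
Qed.

(** Equal coefficients of c and x are one coefficient of c + x, so this wall of the slab is a full
    chamber of the merged steps. *)
Lemma meets_merge_add : pos (p ++ (c + x) :: y) <->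
  exists u, [/\ slab P (q :: Q) u, 1 * u 0%N + -1 * u q = 0 & total_vec P (q :: Q) p (c :: y) u \in W].
Proof.
rewrite (chamber_meets_dec (L := P ++ q :: Q)) //; last by rewrite !size_cat sP /= sQ.
have eqL u : dot (map u (P ++ q :: Q)) (p ++ (c + x) :: y) =
    total_vec P (q :: Q) p (c :: y) (upd u (u q)).
  rewrite map_cat dot_cat ?size_map // /total_vec !map_upd // /upd eqxx /=.
  by rewrite scalerDr -!addrA; congr (_ + (_ + _)); rewrite addrC.
split=> -[u].
  rewrite eqL => -[h1 hW]; exists (upd u (u q)); split=> //; last by rewrite /upd eqxx q0; lra.
  rewrite /slab (dec_upd _ _ PqQ0) h1 /= {1 3}/upd eqxx.
  move: h1; rewrite dec_cat allrel_consr dec_cons => /and3P[/andP[/allP h1 _] h2 /and3P[_ h3 _]].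
  apply/andP; split; first (apply/allP => i iP; rewrite /upd; (case: eqP iP => [->|_ iP]; first by rewrite (negbTE P0))).
    exact: h1.
  apply/implyP => hb; apply/allP => i iP; rewrite /upd; (case: eqP iP => [->|_ iP]; first by rewrite (negbTE P0)).
  move: h3 (h1 i iP); rewrite hb /=; lra.
case=> /and3P[h1 h2 h3] h4 hW; exists u; rewrite eqL; split=> //.
rewrite (_ : upd _ _ = u) //; apply/funext => i; rewrite /upd.
by case: eqP => // ->; lra.
Qed.

Lemma meets_merge_sub : b -> pos (p ++ (c - x) :: y) <->
  exists u, [/\ slab P (q :: Q) u /\ 1 * u 0%N + -1 * u q < 0, 1 * u 0%N + 1 * u q = 0
              & total_vec P (q :: Q) p (c :: y) u \in W].
Proof.
move=> hb; rewrite (chamber_meets_dec (L := P ++ q :: Q)) //; last by rewrite !size_cat sP /= sQ.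
have eqL u : dot (map u (P ++ q :: Q)) (p ++ (c - x) :: y) =
    total_vec P (q :: Q) p (c :: y) (upd u (- u q)).
  rewrite map_cat dot_cat ?size_map // /total_vec !map_upd // /upd eqxx /=.
  by rewrite scalerBr scaleNr -!addrA; congr (_ + (_ + _)); rewrite addrC.
split=> -[u].
  rewrite eqL => -[h1 hW]; exists (upd u (- u q)).
  have hq : 0 < u q by move: h1; rewrite dec_cat dec_cons hb /= => /and3P[_ _ /and3P[]].
  split=> //; last by rewrite /upd eqxx q0; lra.
  split; last by rewrite /upd eqxx q0; lra.
  rewrite /slab (dec_upd _ _ PqQ0) h1 /= {1 3}/upd eqxx.
  move: h1; rewrite dec_cat allrel_consr dec_cons => /and3P[/andP[/allP h1 _] h2 /and3P[_ h3 _]].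
  apply/andP; split; first (apply/allP => i iP; rewrite /upd; (case: eqP iP => [->|_ iP]; first by rewrite (negbTE P0))).
    by move: (h1 i iP); lra.
  apply/implyP => _; apply/allP => i iP; rewrite /upd; (case: eqP iP => [->|_ iP]; first by rewrite (negbTE P0)).
  by rewrite opprK; apply: h1.
case=> -[/and3P[h1 h2 h3] _] h4 hW; exists u; rewrite eqL; split=> //.
rewrite (_ : upd _ _ = u) //; apply/funext => i; rewrite /upd.
by case: eqP => // ->; lra.
Qed.

(** What is left inside the walls of q is the slab with q moved to the prefix: the inductive step
    down the list. *)
Lemma slab_meets_rcons : slab_meets (rcons P q) Q (rcons p c) y <->
  exists u, [/\ slab P (q :: Q) u /\ 1 * u 0%N + -1 * u q < 0, b ==> (0 < 1 * u 0%N + 1 * u q)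
              & total_vec P (q :: Q) p (c :: y) u \in W].
Proof.
have eqL u : total_vec (rcons P q) Q (rcons p c) y u = total_vec P (q :: Q) p (c :: y) u.
  by rewrite /total_vec -!cats1 map_cat dot_cat ?size_map //= addr0 !addrA.
split=> -[u].
  rewrite eqL /slab cat_rcons !all_rcons => -[/and3P[h1 /andP[h2 h3] h4] hW].
  exists u; split=> //.
    rewrite h1 h3; split; last lra.
    by case: b h4 => //= /andP[].
  by case: b h4 => //= /andP[h4 _]; lra.
case=> -[/and3P[h1 h2 h3] h4] h5 hW; exists u; rewrite eqL; split=> //.
rewrite /slab cat_rcons !all_rcons h1 h2 /= andbT; apply/andP; split; first by lra.
by case: b h3 h5 => //= -> ?; rewrite andbT; lra.
Qed.

End Events.
End Slices.

(** * Counting pieces against walls *)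

Section SliceCount.
Variables (R : realFieldType) (V : vectType R) (b : bool) (W : {vspace V}) (x : V).
Implicit Types (P Q : seq nat) (p y : seq V) (u : nat -> R).
Local Notation pos := (chamber_meets b W).
Local Notation tvec := (total_vec x).

Lemma total_vec_upd (v : V) P Q p y u c : 0%N \notin P -> 0%N \notin Q ->
  total_vec v P Q p y (upd u c) = dot (map u P) p + dot (map u Q) y + c *: v.
Proof. by move=> P0 Q0; rewrite /total_vec !map_upd. Qed.

Lemma transversal_merge (e : R) P q Q p (c : V) y :
  size P = size p -> size Q = size y -> uniq (0%N :: P ++ q :: Q) ->
  x \in (W + <<p ++ (c + e *: x)%R :: y>>)%VS ->
  exists2 d, tvec P (q :: Q) p (c :: y) d \in W & 1 * d 0%N + - e * d q = 1.
Proof.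
move=> sP sQ /= /andP[PQ0 uPQ] /memv_addP[w wW [_ /span_dot[l sl ->] xE]].
pose u i := if i \in P ++ q :: Q then nth 0 l (index i (P ++ q :: Q)) else 0.
have lE : map u (P ++ q :: Q) = l by rewrite map_nth_index // sl !size_cat sP /= sQ.
move: (PQ0); rewrite mem_cat inE !negb_or => /and3P[P0 q0 Q0].
(* With x equal to w plus the combination l of the merged steps, the coefficients - l on the steps
   and 1 - e l_q on x sum to w. *)
exists (upd (fun i => - u i) (1 - e * u q)).
  rewrite total_vec_upd //; last by rewrite inE negb_or q0.
  rewrite !dot_map_opp /=; move: xE; rewrite -lE map_cat dot_cat ?size_map //= => xE.
  have -> : - dot (map u P) p - (u q *: c + dot (map u Q) y) + (1 - e * u q) *: x = w; last by [].
  rewrite scalerBl scale1r {1}xE scalerDr scalerA (mulrC e).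
  move: (dot _ p) (dot _ y) (u q *: c) ((u q * e) *: x) => A B C D.
  rewrite (addrAC C D) (addrA A) -opprD (addrA w).
  by rewrite addrK [LHS]addrC addrK.
rewrite /upd eqxx eq_sym (negbTE q0); ring.
Qed.

Lemma transversal_drop P p :
  size P = size p -> uniq (0%N :: P) -> x \in (W + <<p>>)%VS ->
  exists2 d, tvec P [::] p [::] d \in W & 1 * d 0%N + 0 * d 0%N = 1.
Proof.
move=> sP /= /andP[P0 uP] /memv_addP[w wW [_ /span_dot[l sl ->] xE]].
pose u i := if i \in P then nth 0 l (index i P) else 0.
have lE : map u P = l by rewrite map_nth_index // sl sP.
exists (upd (fun i => - u i) 1); last by rewrite /upd eqxx; ring.
rewrite total_vec_upd // dot_map_opp lE /= addr0 scale1r {1}xE [X in X \in W]addrC.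
by rewrite addrK.
Qed.

Lemma slab_flip P u : 0%N \notin P -> slab true P [::] u -> slab true P [::] (upd u (- u 0%N)).
Proof.
move=> P0; rewrite /slab cats0 => /and3P[h1 /allP h2 /allP h3].
rewrite dec_upd // h1 /=; apply/andP; split; apply/allP => i iP; rewrite /upd /=;
  (case: eqP iP => [->|_ iP]; first by rewrite (negbTE P0)); first exact: h3.
by rewrite opprK; exact: h2.
Qed.

Lemma meets_slab_wall P p : size P = size p -> uniq (0%N :: P) ->
  chamber_meets true W p <->
  exists u, [/\ slab true P [::] u, 1 * u 0%N + 0 * u 0%N = 0 & tvec P [::] p [::] u \in W].
Proof.
move=> sP /= /andP[P0 uP]; rewrite (chamber_meets_dec true W sP uP); split=> -[u].
  case=> du uW; exists (upd u 0); split; last 2 first.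
  - by rewrite /upd eqxx; ring.
  - by rewrite total_vec_upd //= addr0 scale0r addr0.
  rewrite /slab cats0 dec_upd // du /=; move: du; rewrite /dec /= => /andP[_ /allP du].
  apply/andP; split; apply/allP => i iP; rewrite /upd /=;
    (case: eqP iP => [->|_ iP]; first by rewrite (negbTE P0)); rewrite ?oppr0; exact: du.
case=> /and3P[h1 h2 h3] h4 hW; exists u; rewrite cats0 in h1; split=> //.
move: hW; have u0 : u 0%N = 0 by lra.
by rewrite /total_vec /= u0 scale0r !addr0.
Qed.

Lemma meets_last_opp P p : size P = size p -> uniq (0%N :: P) ->
  chamber_meets true W (p ++ [:: - x]) <->
  exists u, [/\ slab true P [::] u, 1 * u 0%N + 0 * u 0%N < 0 & tvec P [::] p [::] u \in W].
Proof.
move=> sP uP; rewrite (meets_last true W (- x) sP uP).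
have P0 : 0%N \notin P by case/andP: uP.
split=> -[u] [h1 /= h2 h3]; exists (upd u (- u 0%N)).
  split; [exact: slab_flip|rewrite /upd eqxx; lra|].
  by move: h3; rewrite total_vec_upd // /total_vec scaleNr scalerN.
split; [exact: slab_flip|rewrite /= /upd eqxx; lra|].
by move: h3; rewrite total_vec_upd // /total_vec scaleNr scalerN opprK.
Qed.

(** Passing from y to p, each step peels off the outermost piece c > l_q, with signs also c < - l_q,
    and one wall per piece. At the end one piece remains without signs; with signs, two pieces and
    the wall c = 0. For empty p the slab does not constrain c at all. *)
Lemma sum_chamber_ins y Q p P :
  size P = size p -> size Q = size y -> uniq (0%N :: P ++ Q) ->
  (forall w, w \in mg b x y -> x \in (W + <<p ++ w>>)%VS) ->
  (\sum_(z <- ins b -%R x y) `[< pos (p ++ z) >] =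
   `[< slab_meets b W x P Q p y >] + \sum_(w <- mg b x y) `[< pos (p ++ w) >])%N.
Proof.
have tl P' Q' p' y' := @total_vec_lin _ _ x P' Q' p' y'.
elim: y Q p P => [|c y IH] [|q Q] // p P sP sQ uPQ xW.
  rewrite sum_ins_nil sum_mg_nil cats0; rewrite cats0 in uPQ.
  rewrite (asbool_equiv_eq (meets_last b W x sP uPQ)).
  case: b xW => xW; last first.
    rewrite !mul0n !addn0; congr (nat_of_bool _); apply: asbool_equiv_eq.
    by rewrite /slab_meets; split=> -[u]; [case=> h1 _ h2|case=> h1 h2]; exists u.
  have [|d dW d1] := transversal_drop sP uPQ.
    by have := xW [::]; rewrite cats0; apply; rewrite inE.
  have -> : `[< chamber_meets true W p >] =
     `[< exists u, [/\ slab true P [::] u, 1 * u 0%N + 0 * u 0%N = 0 & tvec P [::] p [::] u \in W] >]%R.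
    by apply: asbool_equiv_eq; exact: meets_slab_wall.
  rewrite !mul1n -(split_open_cone (open_cone_slab R true P [::]) (linear_form_coef 1 0 0 0) (tl _ _ _ _) dW d1).
  congr (_ + _)%N.
    congr (nat_of_bool _); apply: asbool_equiv_eq.
    by split=> -[u [h1 h2 h3]]; exists u; split=> //=; move: h2 => /=; rewrite mul0r addr0 mul1r.
  by congr (nat_of_bool _); apply: asbool_equiv_eq; exact: meets_last_opp.
rewrite sum_ins_cons sum_mg_cons.
have sQ' : size Q = size y by case: sQ.
rewrite (asbool_equiv_eq (meets_before b W x sP sQ' c uPQ)).
rewrite (asbool_equiv_eq (meets_merge_add b W x sP sQ' c uPQ)).
have xadd : x \in (W + <<p ++ (c + 1 *: x)%R :: y>>)%VS.
  by rewrite scale1r; apply: xW; rewrite /= inE eqxx.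
have [d dW d1] := transversal_merge sP sQ' uPQ xadd.
have sp1 := split_open_cone (open_cone_slab R b P (q :: Q)) (linear_form_coef 1 0 (-1) q) (tl _ _ _ _) dW d1.
have {}IH := IH Q (rcons p c) (rcons P q).
rewrite !size_rcons sP in IH; rewrite cat_rcons in IH.
have {}IH := IH erefl sQ' uPQ.
under eq_bigr do rewrite -cat_rcons.
under [in RHS]eq_bigr do rewrite -cat_rcons.
rewrite IH => [|w wy]; last by rewrite cat_rcons; apply: xW; rewrite /= !inE mem_cat map_f ?orbT.
rewrite (asbool_equiv_eq (slab_meets_rcons b W x Q y sP q c)).
case: b sp1 xW {IH} => sp1 xW; last first.
  have e : `[< exists u, [/\ slab false P (q :: Q) u /\ 1 * u 0%N + -1 * u q < 0,
        false ==> (0 < 1 * u 0%N + 1 * u q) & tvec P (q :: Q) p (c :: y) u \in W] >]%R =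
      `[< exists u, [/\ slab false P (q :: Q) u, 1 * u 0%N + -1 * u q < 0 & tvec P (q :: Q) p (c :: y) u \in W] >]%R.
    apply: asbool_equiv_eq.
    by split=> -[u]; [case=> -[h1 h2] _ h3|case=> h1 h2 h3]; exists u.
  rewrite e !mul0n !addn0 /slab_meets; move: sp1.
  do !move: (nat_of_bool `[< _ >]) => ?; move: (\sum_(w <- _) _)%N => S; lia.
rewrite !mul1n.
rewrite (asbool_equiv_eq (meets_before_opp W x sP sQ' c uPQ isT)).
rewrite (asbool_equiv_eq (meets_merge_sub W x sP sQ' c uPQ isT)).
have xsub : x \in (W + <<p ++ (c + (-1) *: x)%R :: y>>)%VS.
  by rewrite scaleN1r; apply: xW; rewrite /= !inE eqxx orbT.
have [d' dW' d1'] := transversal_merge sP sQ' uPQ xsub; rewrite opprK in d1'.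
(* The second cut, along [u 0 = - u q], is made in the part of the slab below the first wall. *)
have O2 : open_cone (fun u => slab true P (q :: Q) u /\ 1 * u 0%N + -1 * u q < 0).
  apply: open_coneI; first exact: open_cone_slab.
  rewrite (_ : (fun u : nat -> R => is_true _) = (fun u => is_true (0 < -1 * u 0%N + 1 * u q))).
    exact/open_cone_lt/linear_form_coef.
  by apply/funext => u; rewrite !mul1r !mulN1r subr_lt0 addrC subr_gt0.
have sp2 := split_open_cone O2 (linear_form_coef 1 0 1 q) (tl _ _ _ _) dW' d1'.
have e : `[< exists u, [/\ slab true P (q :: Q) u, 1 * u 0%N + -1 * u q < 0 & tvec P (q :: Q) p (c :: y) u \in W] >]%R =
   `[< exists u, (slab true P (q :: Q) u /\ 1 * u 0%N + -1 * u q < 0) /\ tvec P (q :: Q) p (c :: y) u \in W >]%R.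
  by apply: asbool_equiv_eq; split=> -[u]; [case=> ? ? ?|case=> -[? ?] ?]; exists u.
rewrite e in sp1; rewrite /slab_meets.
move: sp1 sp2; rewrite /=.
do !move: (nat_of_bool `[< _ >]) => ?; move: (\sum_(w <- _) _)%N => S; lia.
Qed.

End SliceCount.

(** * Partial sums and general position relative to a subspace *)

Section PartialSums.
Variables (R : realFieldType) (V : vectType R).
Implicit Types (b : bool) (W : {vspace V}) (s x : V) (y z t : seq V).

(* The partial sums of y shifted by s; the last one is left out for b = false,
   where it is the closing step of a bridge. *)
Fixpoint psums b s y : seq V :=
  if y is a :: y' then
    if b || ~~ nilp y' then (s + a) :: psums b (s + a) y' else [::]
  else [::].

Lemma size_psums b s y : size (psums b s y) = (size y - ~~ b)%N.
Proof.
elim: y s => [|a y IH] s /=; first by case: b.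
by case: b IH => /= IH; rewrite ?subn0 ?IH ?subn0 //; case: y IH => //= c y ->; rewrite subn1.
Qed.

Lemma psums_shift b s s' y : psums b (s + s') y = map (+%R s) (psums b s' y).
Proof.
elim: y s' => [|a y IH] s' //=; case: ifP => // _.
by rewrite /= -addrA IH.
Qed.

Lemma psums_sub b s y v : v \in psums b s y -> v - s \in <<y>>%VS.
Proof.
elim: y s => [|a y IH] s //=; case: ifP => // _; rewrite inE span_cons.
case/orP => [/eqP ->|/IH h]; first by rewrite addrC addKr (subvP (addvSl _ _)) ?memv_line.
have -> : v - s = a + (v - (s + a)) by rewrite [RHS]addrC opprD (addrA v) subrK.
by rewrite memv_add ?memv_line.
Qed.

(** The merged step a + x jumps over one partial sum of the walk that takes a and then x; likewise
    with - x. A dropped x is compared with x appended at the end. *)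
Lemma psums_mg b x y y' s : y' \in mg b x y ->
  exists2 z, z \in ins b -%R x y & subseq (psums b s y') (psums b s z).
Proof.
elim: y s y' => [|a y IH] s y' /=; first by case: b => //; rewrite inE => /eqP ->; exists [:: x]; rewrite ?inE ?eqxx ?sub0seq.
rewrite inE mem_cat => /or3P[/eqP ->||/mapP[y0 y0y ->]].
- exists [:: a, x & y].
    rewrite inE mem_cat map_f ?orbT //.
    by case: (y) => [|? ?]; rewrite inE eqxx.
  have -> : psums b s (a + x :: y) = psums b (s + a) (x :: y) by rewrite /= addrA.
  have -> : psums b s [:: a, x & y] = (s + a) :: psums b (s + a) (x :: y) by rewrite /= orbT.
  exact: subseq_cons.
- case: b {IH} => //; rewrite inE => /eqP ->; exists [:: a, - x & y].
    rewrite !inE map_f ?orbT //.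
    by case: (y) => [|? ?]; rewrite !inE eqxx orbT.
  have -> : psums true s (a - x :: y) = psums true (s + a) (- x :: y) by rewrite /= addrA.
  exact: subseq_cons.
- have [z zi zs] := IH (s + a) _ y0y; exists (a :: z).
    by rewrite inE mem_cat map_f // !orbT.
  rewrite /=; case: ifP => // h; last exact: sub0seq.
  have -> : b || ~~ nilp z by rewrite /nilp (ins_size zi) orbT.
  by rewrite /= eqxx.
Qed.

(** Spanning by exactly codimension many vectors amounts to independence modulo W; in this form it
    passes to merged tuples and to quotients. *)
Definition generic b W y := forall t, subseq t (psums b 0 y) ->
  (size t + \dim W)%N = \dim {:V} -> (W + <<t>>)%VS = fullv.

Lemma generic_mg b W x y y' : (forall z, z \in ins b -%R x y -> generic b W z) ->
  y' \in mg b x y -> generic b W y'.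
Proof.
move=> gy /(psums_mg 0)[z zi zs] t ts; apply: (gy z zi).
exact: subseq_trans zs.
Qed.

Lemma generic_span b W y d : generic b W y -> (d + \dim W)%N = \dim {:V} ->
  (d + ~~ b <= size y)%N -> (W + <<y>>)%VS = fullv.
Proof.
move=> gy dW dy; apply/eqP; rewrite eqEsubv subvf /= -(gy (take d (psums b 0 y))).
- apply: addvS => //; apply/span_subvP => v /mem_take /psums_sub.
  by rewrite subr0.
- exact: take_subseq.
- by rewrite size_take_min size_psums (minn_idPl _) //; case: b {gy} dy => /=; lia.
Qed.

Lemma dim_addv_le (U U' : {vspace V}) : (\dim (U + U') <= \dim U + \dim U')%N.
Proof. by case: (dimv_add_leqif U U'). Qed.

(** Beside x itself, the partial sums of [x :: y] are those of y shifted by x, and the shift is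
    invisible modulo W + <x>. *)
Lemma generic_quotient b W x y d : generic b W (x :: y) ->
  (d.+1 + \dim W)%N = \dim {:V} -> (d.+1 + ~~ b <= (size y).+1)%N ->
  generic b (W + <[x]>)%VS y /\ (d + \dim (W + <[x]>))%N = \dim {:V}.
Proof.
move=> gxy dW dy.
have psE : psums b 0 (x :: y) = x :: map (+%R x) (psums b 0 y).
  rewrite -psums_shift /= add0r addr0; case: ifP => // /negbT.
  by rewrite negb_or negbK => /andP[/negbTE hb /nilP hy]; move: dy; rewrite hb hy /=; lia.
have sp t : (size t = d)%N -> subseq t (psums b 0 y) -> (W + <[x]> + <<t>>)%VS = fullv.
  move=> st ts; apply/eqP; rewrite eqEsubv subvf /= -(gxy (x :: map (+%R x) t)).
  - rewrite span_cons addvA; rewrite subv_add addvSl /=.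
    apply/span_subvP => _ /mapP[v vt ->]; apply: memv_add; last exact: memv_span.
    by rewrite (subvP (addvSr _ _)) ?memv_line.
  - by rewrite psE /= eqxx; apply: map_subseq.
  - by rewrite /= size_map st.
(* Only d vectors complete W + <x>, so its dimension exceeds that of W by one and x is not in W. *)
have dx : (d + \dim (W + <[x]>))%N = \dim {:V}.
  pose t := take d (psums b 0 y).
  have st : size t = d.
    by rewrite size_take_min size_psums (minn_idPl _) //; case: b {gxy psE sp t} dy => /=; lia.
  have := dim_addv_le (W + <[x]>) <<t>>; rewrite sp // ?take_subseq // => h1.
  have := dim_span t; rewrite st => h2.
  have := dim_addv_le W <[x]>; rewrite (dim_vline x) => h3.
  by have := leq_b1 (x != 0); lia.
split=> // t ts dt; apply: sp => //; lia.
Qed.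

(* Summation by parts: l_1 - l_2, l_2 - l_3, ... are the coefficients of the
   partial sums. *)
Lemma dot_psums b l (ls : seq R) a y s : size ls = size y ->
  pairwise >%R (l :: ls) -> b ==> all (> 0) (l :: ls) ->
  let e := if b then 0 else last l ls in
  exists mu, [/\ size mu = size (psums b s (a :: y)), all (> 0) mu &
    dot mu (psums b s (a :: y)) =
    (l - e) *: s + dot (l :: ls) (a :: y) - e *: (\sum_(v <- a :: y) v)].
Proof.
elim: y l ls a s => [|c y IH] l [|l' ls] // a s sl dl pl e.
  rewrite /= big_seq1; case: b pl @e => /= [pl|_].
    exists [:: l]; split=> //; rewrite /= subr0 scale0r subr0 scalerDr addrA //.
  by exists [::]; split=> //=; rewrite subrr scale0r add0r addr0 subrr.
have [|||mu [smu pmu dmu]] := IH l' ls c (s + a).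
- by case: sl.
- by move: dl => /= /andP[].
- by case: b pl {IH e} => //= /andP[].
exists ((l - l') :: mu); rewrite /= orbT /=.
split; first by rewrite smu.
  rewrite pmu andbT subr_gt0; by move: dl => /= /andP[/andP[]].
rewrite [psums b _ _]/psums -/psums in dmu *.
move: dmu; rewrite /= => ->.
have -> : (if b then 0 else last l' ls) = e by [].
have -> : \sum_(v <- [:: a, c & y]) v = a + \sum_(v <- c :: y) v by rewrite big_cons.
rewrite !scalerDr opprD.
have -> : (l - e) *: s = (l - l') *: s + (l' - e) *: s by rewrite -scalerDl addrA subrK.
have -> : l *: a = (l - l') *: a + (l' - e) *: a + e *: a.
  by rewrite -!scalerDl addrA subrK subrK.
move: ((l - l') *: s) ((l' - e) *: s) ((l - l') *: a) ((l' - e) *: a) (e *: a) => A1 A2 B1 B2 B3.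
move: (l' *: c + dot ls y) (e *: \sum_(v <- c :: y) v) => X S.
rewrite !addrA (addrAC A1 B1 A2); congr (_ - _).
by rewrite (addrAC _ B3 X) addrK.
Qed.


(** Without signs the last coefficient e need not vanish, but it multiplies the total sum, which
    lies in W because the walk closes up modulo W. *)
Lemma chamber_meets_psums b W y : chamber_meets b W y -> b || (\sum_(v <- y) v \in W) ->
  exists mu : seq R, [/\ size mu = size (psums b 0 y), all (> 0) mu & dot mu (psums b 0 y) \in W].
Proof.
case: y => [|a y] [l [sl dl pl dW]] bW; first by exists [::]; rewrite /= mem0v.
case: l sl dl pl dW => [|l ls] // sl dl pl dW.
have [|mu [smu pmu dmu]] := @dot_psums b l ls a y 0 _ dl pl; first by case: sl.
exists mu; split=> //; rewrite dmu scaler0 add0r memvB //.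
by case: b bW {pl smu dmu} => /= [_|?]; rewrite ?scale0r ?mem0v ?memvZ.
Qed.

(** The boundary value 0 of the recurrence: the d + 1 partial sums are independent modulo W, so no
    combination with positive coefficients lies in W. *)
Lemma generic_not_meets b W y d : generic b W y -> b || (\sum_(v <- y) v \in W) ->
  (d.+1 + \dim W)%N = \dim {:V} -> size y = (d.+1 + ~~ b)%N -> ~ chamber_meets b W y.
Proof.
move=> gy bW dW sy /chamber_meets_psums /(_ bW)[mu [smu pmu muW]].
have sps : size (psums b 0 y) = d.+1 by rewrite size_psums sy addnK.
have := gy _ (subseq_refl _); rewrite sps => /(_ dW).
case: (psums b 0 y) sps mu smu pmu muW => [|v t] // [st] [|m mu] //= _ /andP[m0 _] muW.
rewrite span_cons addvA => full.
suff : (\dim {:V} <= d + \dim W)%N by lia.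
(* As m is nonzero, v can be solved for; then the d vectors of t would fill codimension d + 1. *)
rewrite -full; have vW : v \in (W + <<t>>)%VS.
  have -> : v = m^-1 *: ((m *: v + dot mu t) - dot mu t).
    by rewrite addrK scalerA mulVf ?scale1r // gt_eqF.
  rewrite memvZ // memvB //; first exact: (subvP (addvSl _ _)).
  by rewrite (subvP (addvSr _ _)) // dot_span.
have -> : (W + <[v]> + <<t>> = W + <<t>>)%VS.
  by rewrite -addvA (addvC <[v]>%VS) addvA; apply/addv_idPl; rewrite -memvE.
by rewrite (leq_trans (dim_addv_le _ _)) // addnC leq_add2r -st dim_span.
Qed.

Lemma chamber_meets_full b y : chamber_meets b fullv y.
Proof.
apply/(@chamber_meets_lab _ _ b fullv y (iota 0 (size y))); rewrite ?size_iota ?iota_uniq //.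
exists (fun i => i.+1%:R^-1); split; last exact: memvf.
  have := iota_ltn_sorted 0 (size y); rewrite sorted_pairwise; last exact: ltn_trans.
  apply: sub_pairwise => i j ij.
  by rewrite /= ltf_pV2 ?posrE ?ltr0n // ltr_nat ltnS.
by apply/implyP => _; apply/allP => i _; rewrite invr_gt0 ltr0n.
Qed.

Lemma sum_ins x y z : z \in ins false -%R x y -> \sum_(v <- z) v = x + \sum_(v <- y) v.
Proof.
elim: y z => [|a y IH] z /=; rewrite inE; first by move=> /eqP ->; rewrite big_cons.
case/orP => [/eqP ->|]; first by rewrite big_cons.
by move=> /mapP[z' /IH e ->]; rewrite !big_cons e addrCA.
Qed.

Lemma sum_sp (s : seq V) y : y \in sp false -%R s -> \sum_(v <- y) v = \sum_(v <- s) v.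
Proof.
elim: s y => [|x s IH] y /=; first by rewrite inE => /eqP ->.
by case/flattenP => l /mapP[z /IH e ->] /sum_ins ->; rewrite e big_cons.
Qed.

Lemma sum_mg x y z : z \in mg false x y -> \sum_(v <- z) v = x + \sum_(v <- y) v.
Proof.
elim: y z => [|a y IH] z //=; rewrite inE => /orP[/eqP ->|].
  by rewrite !big_cons addrA (addrC a).
by move=> /mapP[z' /IH e ->]; rewrite !big_cons e addrCA.
Qed.

End PartialSums.

(** d is the codimension of W. The test [n <= d + ~~ b] detects walks with at most d partial sums;
    in codimension 0 every chamber is met. *)
Fixpoint nmeet b n d : nat :=
  if d is d'.+1 then
    if n is n'.+1 then
      if (n <= d + ~~ b)%N then 0%N
      else (nmeet b n' d' + slots b n' * nmeet b n' d)%N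
    else 0%N
  else sp_total b n.

Lemma mem_sp_cons (T : eqType) b neg (x : T) s y z :
  y \in sp b neg s -> z \in ins b neg x y -> z \in sp b neg (x :: s).
Proof. by move=> ys zy; apply/flattenP; exists (ins b neg x y) => //; apply: map_f. Qed.

(** W is arbitrary because the induction replaces it by W + <x>; for the same reason a bridge only
    has to close modulo W. *)
Theorem sum_chamber_meets (R : realFieldType) (V : vectType R) b (W : {vspace V}) s d :
  b || (\sum_(v <- s) v \in W) ->
  (forall y, y \in sp b -%R s -> generic b W y) ->
  (d + \dim W)%N = \dim {:V} -> (d + ~~ b <= size s)%N ->
  (\sum_(y <- sp b -%R s) `[< chamber_meets b W y >] = nmeet b (size s) d)%N.
Proof.
move sn : (size s) => n; elim: n d s sn W => [|n IH] [|d] s sn W bW gs dW ds //.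
- have -> : W = fullv by apply/eqP; rewrite eqEdim subvf -dW add0n leqnn.
  by rewrite (size0nil sn) /= big_seq1 asboolT //; apply: chamber_meets_full.
- have -> : W = fullv by apply/eqP; rewrite eqEdim subvf -dW add0n leqnn.
  have -> : nmeet b n.+1 0 = sp_total b (size s) by rewrite sn.
  rewrite (eq_bigr (fun=> 1%N)) ?sum1_size ?size_sp // => y _.
  by rewrite asboolT //; apply: chamber_meets_full.
case: s sn bW gs ds => // x s [sn] bW gs ds.
have bW' y : y \in sp b -%R (x :: s) -> b || (\sum_(v <- y) v \in W).
  by move=> ys; case: b {IH gs ds} bW ys => // bW /sum_sp ->.
rewrite [RHS]/=; case: ifP => [nd|/negbT nd].
  rewrite big_seq big1 // => y ys; rewrite asboolF //.
  apply: (generic_not_meets (gs y ys) (bW' y ys) dW).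
  by rewrite (sp_size ys) /= sn; apply/eqP; rewrite eqn_leq nd ds.
have nd' : (d.+1 + ~~ b <= n)%N by rewrite -ltnS ltnNge.
have gmg y y' : y \in sp b -%R s -> y' \in mg b x y -> generic b W y'.
  by move=> ys; apply: generic_mg => z zi; apply: gs; apply: mem_sp_cons zi.
have gq y : y \in sp b -%R s -> generic b (W + <[x]>)%VS y /\ (d + \dim (W + <[x]>))%N = \dim {:V}.
  move=> ys; apply: generic_quotient => //.
    by apply: gs; apply: (mem_sp_cons ys); case: (y) => [|? ?]; rewrite /= inE eqxx.
  by rewrite (sp_size ys) sn; lia.
(* With an empty prefix the coefficient of x is free, so x can be absorbed into the subspace. *)
rewrite sum_sp_cons (eq_big_seq (fun y => `[< chamber_meets b (W + <[x]>)%VS y >] +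
    \sum_(w <- mg b x y) `[< chamber_meets b W w >])%N); last first.
  move=> y ys; have := @sum_chamber_ins _ V b W x y (iota 1 (size y)) [::] [::] erefl.
  rewrite size_iota => /(_ erefl) h; rewrite h; first last.
  - move=> w wy; rewrite /= (generic_span (gmg _ _ ys wy) dW) ?memvf //.
    by rewrite (mg_size wy) (sp_size ys) sn.
  - by rewrite /= iota_uniq andbT mem_iota.
  congr (_ + _)%N; congr (nat_of_bool _); apply: asbool_equiv_eq.
  rewrite (@chamber_meets_dec _ _ b _ y (iota 1 (size y))) ?size_iota ?iota_uniq //.
  split=> -[u].
    case=> /and3P[h1 _ _]; rewrite /total_vec /= add0r => h2; exists u; split=> //.
    rewrite -[dot _ _](addrK (u 0%N *: x)) memvB //; first exact: (subvP (addvSl _ _)).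
    by rewrite (subvP (addvSr _ _)) // memvZ ?memv_line.
  case=> du /memv_addP[w wW [_ /vlineP[c ->] e]].
  have i0 : 0%N \notin iota 1 (size y) by rewrite mem_iota.
  exists (upd u (- c)); rewrite /slab /= dec_upd // du implybT total_vec_upd //=.
  by split=> //; rewrite add0r e scaleNr addrK.
(* The quotient term has codimension d; the walls regroup into merged tuples, still of codimension d
   + 1. *)
rewrite big_split /= sum_sp_mg; congr (_ + _)%N.
  have [y0 y0s] : exists y, y \in sp b -%R s.
    have : (0 < size (sp b -%R s))%N.
      by rewrite size_sp; elim: (size s) => //= m IHm; rewrite muln_gt0.
    by case: (sp b _ s) => // y0 l _; exists y0; rewrite mem_head.
  apply: IH => //.
  - case: b bW {gs ds bW' nd nd' gmg gq y0s} => //= bW.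
    rewrite big_cons in bW; rewrite -[\sum_(_ <- _) _](addKr x) [X in X \in _]addrC.
    rewrite memvB //; first exact: (subvP (addvSl _ _)).
    by rewrite (subvP (addvSr _ _)) // memv_line.
  - by move=> y /gq[].
  - by have [] := gq _ y0s.
rewrite (eq_big_seq (fun=> nmeet b n d.+1)) => [|s' s's].
  by rewrite big_const_seq count_predT iter_addn_0 mulnC size_mg sn.
apply: IH => //.
- by rewrite (mg_size s's).
- case: b bW s's {gs ds bW' nd nd' gmg gq} => //= bW /sum_mg ->.
  by rewrite big_cons in bW.
- by move=> y ys'; have [y0 y0s yy0] := mem_sp_mg s's ys'; apply: (gmg y0).
Qed.

(** * From convex hulls to chambers *)

Section ConvexHull.
Variables (R : realType) (d : nat).

(* The relative interior of a face carrying 0 can be enlarged to the whole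
   family: d of the vectors in the face express all the other ones. *)
Lemma zero_in_conv_pos m (v : 'I_m -> 'rV[R]_d) : (d <= m)%N ->
  any_d_indep v -> zero_in_conv v ->
  exists mu : 'I_m -> R, (forall i, 0 < mu i) /\ \sum_i mu i *: v i = 0.
Proof.
move=> dm vi [lam [lam0 [lam1 lamv]]].
pose Z := [set i | 0 < lam i]%SET.
have [i0 i0Z] : exists i, i \in Z.
  apply/existsP; apply: contraT; rewrite negb_exists => /forallP h.
  have : \sum_i lam i = 0.
    apply: big1 => i _; apply/eqP; rewrite eq_le lam0 andbT leNgt.
    by have := h i; rewrite inE.
  by rewrite lam1 => /eqP; rewrite oner_eq0.
have lamZ i : i \notin Z -> lam i = 0.
  by rewrite inE -leNgt => h; apply/eqP; rewrite eq_le h lam0.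
(* With the support listed first, the first d indices either contain it or lie inside it. The former
   contradicts independence. *)
pose s := enum Z ++ enum (~: Z)%SET.
have us : uniq s.
  rewrite cat_uniq !enum_uniq /= andbT; apply/hasPn => i; rewrite !mem_enum /=.
  by rewrite inE.
have ss : size s = m by rewrite size_cat -!cardE cardsC card_ord.
pose f (k : 'I_d) := nth i0 s k.
have ks (k : 'I_d) : (k < size s)%N by rewrite ss (leq_trans (ltn_ord k)).
have fi : injective f.
  by move=> k l /eqP; rewrite /f nth_uniq // => /eqP /val_inj.
have := vi f fi; set M := (\matrix_(k < d) _) => Mfree.
have Mu : M \in unitmx by rewrite -row_free_unit.
have rowM k : row k M = v (f k) by rewrite rowK.
have [Zd|dZ] := leqP #|Z| d.
  pose c : 'rV[R]_d := \row_k lam (f k).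
  have cM : c *m M = 0.
    transitivity (\sum_i lam i *: v i); last exact: lamv.
    rewrite mulmx_sum_row.
    rewrite [RHS](bigID (mem (f @: 'I_d)%SET)) /= [X in _ + X]big1 ?addr0; last first.
      move=> i ni; rewrite lamZ ?scale0r //; apply: contra ni => iZ.
      have iZ' : (index i (enum Z) < #|Z|)%N by rewrite cardE index_mem mem_enum.
      apply/imsetP; exists (Ordinal (leq_trans iZ' Zd)) => //.
      by rewrite /f /s /= nth_cat -cardE iZ' nth_index ?mem_enum.
    rewrite big_imset /=; last by move=> ? ? _ _; apply: fi.
    by apply: eq_big => [k|k _]; rewrite ?inE // mxE rowM.
  have c0 : c = 0 by rewrite -[c](mulmxK Mu) cM mul0mx.
  have iZ' : (index i0 (enum Z) < #|Z|)%N by rewrite cardE index_mem mem_enum.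
  have := congr1 (fun c : 'rV_d => c 0 (Ordinal (leq_trans iZ' Zd))) c0.
  rewrite !mxE /f /s /= nth_cat -cardE iZ' nth_index ?mem_enum // => h.
  by move: i0Z; rewrite inE h ltxx.
have fZ k : f k \in Z.
  have kZ : (k < #|Z|)%N by rewrite (leq_trans (ltn_ord k)) // ltnW.
  by rewrite /f /s nth_cat -cardE kZ -mem_enum mem_nth // -cardE.
pose c j : 'rV[R]_d := v j *m invmx M.
have vE j : v j = \sum_k c j 0 k *: v (f k).
  rewrite -[LHS](mulmxKV Mu) -/(c j) mulmx_sum_row.
  by apply: eq_bigr => k _; rewrite rowM.
(* A linear relation with coefficient 1 off the support, compensated on the d chosen vectors; a
   large multiple of [lam] then outweighs the compensation. *)
pose nu i := (i \notin Z)%:R - \sum_(j | j \notin Z) \sum_k c j 0 k * (f k == i)%:R.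
have nuv : \sum_i nu i *: v i = 0.
  rewrite /nu; under eq_bigr do rewrite scalerBl scaler_suml.
  rewrite sumrB exchange_big /=.
  rewrite (eq_bigr (fun i => if i \notin Z then v i else 0)); last first.
    by move=> i _; case: ifP; rewrite ?scale1r ?scale0r.
  rewrite -big_mkcond /= -sumrB big1 // => j _.
  apply/eqP; rewrite subr_eq0 {1}vE; apply/eqP.
  under [RHS]eq_bigr do rewrite scaler_suml.
  rewrite exchange_big /=; apply: eq_bigr => k _.
  rewrite (bigD1 (f k)) //= eqxx mulr1 big1 ?addr0 // => i ik.
  by rewrite eq_sym (negbTE ik) mulr0 scale0r.
pose N := 1 + \sum_(i in Z) `|nu i| / lam i.
exists (fun i => N * lam i + nu i); split; last first.
  under eq_bigr do rewrite scalerDl -scalerA.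
  by rewrite big_split /= nuv addr0 -scaler_sumr lamv scaler0.
move=> i; have [iZ|iZ] := boolP (i \in Z); last first.
  rewrite lamZ // mulr0 add0r /nu iZ big1 ?subr0 ?ltr01 // => j _.
  rewrite big1 // => k _; case: eqP => [fk|_]; last by rewrite mulr0.
  by move: iZ; rewrite -fk fZ.
have li : 0 < lam i by move: iZ; rewrite inE.
have NE : 1 + `|nu i| / lam i <= N.
  rewrite /N (bigD1 i) //= lerD2l lerDl; apply: sumr_ge0 => j _.
  by rewrite divr_ge0.
have : lam i + `|nu i| <= N * lam i.
  by rewrite -ler_pdivrMr // mulrDl divff ?gt_eqF.
have := ler_norm (- nu i); rewrite normrN; lra.
Qed.

Variables (n : nat) (b : bool) (m : nat) (y : 'I_n -> 'rV[R]_d).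
Hypothesis mE : m = (n - ~~ b)%N.

Definition walk_sum k : 'rV[R]_d := \sum_(i < n | (i < k)%N) y i.
Definition walk_fam (i : 'I_m) := walk_sum i.+1.
Definition steps : seq 'rV[R]_d := [seq y i | i <- enum 'I_n].

Lemma size_steps : size steps = n.
Proof. by rewrite size_map size_enum_ord. Qed.

Lemma nth_psums (V : vectType R) (s : V) z k : (k < size z - ~~ b)%N ->
  nth 0 (psums b s z) k = s + \sum_(v <- take k.+1 z) v.
Proof.
elim: z s k => [|a z IH] s k //= kz.
have -> : b || ~~ nilp z by case: b kz {IH} => //; case: z => //=; rewrite subn1.
case: k kz => [|k] kz /=; first by rewrite take0 big_seq1.
rewrite IH ?big_cons ?addrA //; case: b kz {IH} => //=; rewrite ?subn0 ?subn1 //=.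
by case: (size z).
Qed.

Lemma sum_take_steps k : \sum_(v <- take k steps) v = walk_sum k.
Proof.
rewrite /walk_sum /steps -map_take big_map.
have [nk|kn] := leqP n k.
  rewrite take_oversize ?size_enum_ord // big_enum /=.
  by apply: eq_bigl => i; rewrite (leq_trans (ltn_ord i) nk).
have e : [seq val i | i <- take k (enum 'I_n)] =
         [seq val i | i <- [seq i : 'I_n <- enum 'I_n | (i < k)%N]].
  rewrite map_take val_enum_ord take_iota (minn_idPl (ltnW kn)).
  rewrite -(filter_map val (fun i => (i < k)%N)) val_enum_ord.
  rewrite -(subnKC (ltnW kn)) iotaD filter_cat -[LHS]cats0; congr (_ ++ _).
    by apply/esym/all_filterP/allP => i; rewrite mem_iota add0n.
  apply/esym/eqP; rewrite -[_ == _]negbK -has_filter; apply/hasPn => i.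
  by rewrite mem_iota add0n -leqNgt => /andP[].
by rewrite (inj_map val_inj e) big_filter big_enum_cond.
Qed.

Lemma nth_psums_steps (i : 'I_m) : nth 0 (psums b 0 steps) i = walk_fam i.
Proof. by rewrite nth_psums ?sum_take_steps ?add0r // size_steps -mE. Qed.

Lemma generic_steps : any_d_indep walk_fam -> generic b 0%VS steps.
Proof.
move=> vi t /subseqP[ms sms ->]; rewrite dimv0 addn0 dimvf /dim /= mul1n.
rewrite size_psums size_steps -mE in sms.
have psE : psums b 0 steps = map (nth 0 (psums b 0 steps)) (iota 0 m).
  apply: (@eq_from_nth _ 0); rewrite ?size_map size_psums size_steps -mE ?size_iota // => i im.
  by rewrite (nth_map 0%N) ?size_iota // nth_iota.
rewrite psE -map_mask size_map; set u := mask ms (iota 0 m) => su.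
have uu : uniq u by rewrite mask_uniq // iota_uniq.
have um (k : 'I_d) : (nth 0%N u k < m)%N.
  have /mem_mask : nth 0%N u k \in u by rewrite mem_nth // su.
  by rewrite mem_iota.
pose f (k : 'I_d) := Ordinal (um k).
have fi : injective f.
  by move=> k l /(congr1 val) /= /eqP; rewrite nth_uniq ?su // => /eqP /val_inj.
have := vi f fi; set M := (\matrix_(k < d) _) => Mfree.
have Mu : M \in unitmx by rewrite -row_free_unit.
rewrite add0v; apply/eqP; rewrite eqEsubv subvf /=; apply/subvP => x _.
rewrite -[x](mulmxKV Mu) mulmx_sum_row; apply: memv_suml => k _; apply: memvZ.
apply: memv_span; rewrite rowK /f -nth_psums_steps /=.
by apply/mapP; exists (nth 0%N u k) => //; rewrite mem_nth ?su.
Qed.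

Lemma dot_fun (V : vectType R) p (mu : 'I_p -> R) (v : 'I_p -> V) :
  dot (map mu (enum 'I_p)) (map v (enum 'I_p)) = \sum_i mu i *: v i.
Proof.
rewrite -big_enum /=; elim: (enum _) => [|i l IH] /=; first by rewrite big_nil.
by rewrite big_cons IH.
Qed.

(** Summation by parts: the coefficient of step i is the sum of the weights [mu k] with k >= i. It
    decreases strictly because all weights are positive, which is why [zero_in_conv_pos] comes
    first. For a bridge the last coefficient is the empty sum. *)
Lemma zero_in_conv_chamber : (0 < m)%N -> (d <= m)%N -> any_d_indep walk_fam ->
  b || (\sum_i y i == 0) ->
  zero_in_conv walk_fam <-> chamber_meets b 0%VS steps.
Proof.
move=> m0 dm vi bS; have sumy : \sum_(v <- steps) v = \sum_i y i.
  by rewrite /steps big_map big_enum.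
split=> [/(zero_in_conv_pos dm vi)[mu [mu0 muv]]|].
  pose la (i : 'I_n) := \sum_(k < m | (i <= k)%N) mu k.
  exists (map la (enum 'I_n)); rewrite !size_map; split=> //.
  - rewrite pairwise_map; have := iota_ltn_sorted 0 n.
    rewrite sorted_pairwise; last exact: ltn_trans.
    rewrite -val_enum_ord pairwise_map; apply: sub_pairwise => i j /= ij.
    have im : (i < m)%N.
      rewrite mE; apply: leq_trans (_ : n.-1 <= _)%N; last by case: b; rewrite ?subn0 ?leq_pred ?subn1.
      by rewrite (leq_trans ij) // -ltnS prednK // (leq_trans _ (ltn_ord j)).
    rewrite /la [ltRHS](bigID (fun k : 'I_m => (j <= k)%N)) /=.
    rewrite [X in _ < X + _](eq_bigl (fun k : 'I_m => (j <= k)%N)); last first.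
      by move=> k; rewrite andb_idl // => /(leq_trans (ltnW ij)).
    rewrite ltrDl (bigD1 (Ordinal im)) /=; last by rewrite leqnn -ltnNge.
    by rewrite ltr_pwDl // sumr_ge0 // => k _; rewrite ltW.
  - apply/implyP => hb; apply/allP => _ /mapP[i _ ->].
    have im : (i < m)%N by rewrite mE hb subn0.
    rewrite /la (bigD1 (Ordinal im)) //= ltr_pwDl // sumr_ge0 // => k _.
    by rewrite ltW.
  rewrite dot_fun memv0 /la; under eq_bigr do rewrite scaler_suml.
  rewrite (exchange_big_dep predT) //=; apply/eqP; rewrite -[RHS]muv.
  apply: eq_bigr => k _; rewrite /walk_fam /walk_sum scaler_sumr.
  by apply: eq_bigl => i; rewrite ltnS.
move=> cm; have [|mu [smu pmu]] := chamber_meets_psums cm.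
  by rewrite sumy memv0.
rewrite memv0 => /eqP dmu.
have smu' : size mu = m by rewrite smu size_psums size_steps -mE.
pose mf (i : 'I_m) := nth 0 mu i.
have muE : mu = map mf (enum 'I_m).
  apply: (@eq_from_nth _ 0) => [|i]; first by rewrite smu' size_map -cardE card_ord.
  rewrite smu' => im.
  by rewrite (nth_map (Ordinal im)) ?size_enum_ord // /mf nth_enum_ord.
have psE : psums b 0 steps = map walk_fam (enum 'I_m).
  apply: (@eq_from_nth _ 0) => [|i]; first by rewrite size_psums size_steps -mE size_map -cardE card_ord.
  rewrite size_psums size_steps -mE => im.
  rewrite (nth_map (Ordinal im)) ?size_enum_ord // -nth_psums_steps.
  by rewrite nth_enum_ord.
rewrite muE psE dot_fun in dmu.
have mf0 i : 0 < mf i by rewrite (allP pmu) // mem_nth // smu'.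
have S0 : 0 < \sum_i mf i.
  rewrite (bigD1 (Ordinal m0)) //= ltr_pwDl // sumr_ge0 // => i _.
  by rewrite ltW.
exists (fun i => (\sum_i mf i)^-1 * mf i); split=> [i|].
  by rewrite mulr_ge0 ?invr_ge0 ?ltW.
split; first by rewrite -mulr_sumr mulVf // gt_eqF.
by under eq_bigr do rewrite -scalerA; rewrite -scaler_sumr dmu scaler0.
Qed.

End ConvexHull.

(** * Separation of finitely many vectors from 0 *)

Section Gordan.
Variable R : realFieldType.

Lemma fin_lub (I : finType) (A : pred I) (lo : I -> R) : exists x, forall i, A i -> lo i <= x.
Proof.
exists (\sum_i `|lo i|) => i _; apply: le_trans (ler_norm _) _.
by rewrite (bigD1 i) //= lerDl sumr_ge0.
Qed.

Lemma fin_between (I J : finType) (A : pred I) (B : pred J) (lo : I -> R) (hi : J -> R) :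
  (forall i j, A i -> B j -> lo i < hi j) ->
  exists x, (forall i, A i -> lo i < x) /\ (forall j, B j -> x < hi j).
Proof.
move=> lh; have [/existsP[i0 Ai0]|/existsPn nA] := boolP [exists i, A i]; last first.
  have [x hx] := fin_lub B (fun j => - hi j); exists (- x - 1); split=> [i Ai|j Bj].
    by have := nA i; rewrite Ai.
  by have := hx j Bj; lra.
have [/existsP[j0 Bj0]|/existsPn nB] := boolP [exists j, B j]; last first.
  have [x hx] := fin_lub A lo; exists (x + 1); split=> [i Ai|j Bj].
    by have := hx i Ai; lra.
  by have := nB j; rewrite Bj.
have := @Order.TotalTheory.arg_maxP _ _ _ i0 A lo Ai0.
case=> i Ai hi1; have [j Bj hj1] := @Order.TotalTheory.arg_minP _ _ _ j0 B hi Bj0.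
have := lh i j Ai Bj; exists ((lo i + hi j) / 2); split=> [k Ak|k Bk].
  have := hi1 k Ak; rewrite /=; lra.
have := hj1 k Bk; rewrite /=; lra.
Qed.

(* Fourier-Motzkin elimination of the last coordinate of u. *)
Theorem gordan d (I : finType) (v : I -> 'I_d -> R) :
  (exists u : 'I_d -> R, forall i, 0 < \sum_j u j * v i j) \/
  (exists lam : I -> R, [/\ forall i, 0 <= lam i, 0 < \sum_i lam i & forall j, \sum_i lam i * v i j = 0]).
Proof.
elim: d I v => [|d IH] I v.
  have [/existsP[i _]|/existsPn nI] := boolP [exists i : I, true].
    right; exists (fun k => (k == i)%:R); split=> [k||[]//]; first by rewrite ler0n.
    by rewrite (bigD1 i) //= eqxx ltr_pwDl ?ltr01 // sumr_ge0 // => k _; rewrite ler0n.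
  by left; exists (fun=> 0) => i; have := nI i.
pose p i := v i ord_max; pose v' i (j : 'I_d) := v i (widen_ord (leqnSn d) j).
(* The eliminated system: each pair of opposite signs in the last coordinate gives one inequality,
   and inequalities free of that coordinate are kept. *)
pose J := ({i : I | 0 < p i} * {i : I | p i < 0} + {i : I | p i == 0})%type.
pose w (k : J) (j : 'I_d) : R := match k with
  | inl (i1, i2) => v' (val i1) j / p (val i1) - v' (val i2) j / p (val i2)
  | inr i => v' (val i) j end.
case: (IH J w) => [[u hu]|[lam [lam0 lam1 lamw]]].
  left.
  have [x [h1 h2]] : exists x, (forall i, 0 < p i -> - (\sum_j u j * v' i j) / p i < x) /\
      (forall i, p i < 0 -> x < - (\sum_j u j * v' i j) / p i).
    apply: (@fin_between I I (fun i => 0 < p i) (fun i => p i < 0)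
      (fun i => - (\sum_j u j * v' i j) / p i) (fun i => - (\sum_j u j * v' i j) / p i)) => i1 i2 p1 p2.
    have := hu (inl (exist _ i1 p1, exist _ i2 p2)); rewrite /w /=.
    under eq_bigr do rewrite mulrBr !mulrA.
    rewrite sumrB -!mulr_suml; lra.
  exists (fun j => if unlift ord_max j is Some k then u k else x) => i.
  rewrite big_ord_recr /= unlift_none.
  rewrite (eq_bigr (fun j => u j * v' i j)); last first.
    move=> j _; have -> : widen_ord (leqnSn d) j = lift ord_max j.
      by apply: val_inj; rewrite /= /bump leqNgt ltn_ord.
    by rewrite liftK /v'; congr (_ * v i _); apply: val_inj; rewrite /= /bump leqNgt ltn_ord.
  rewrite -/(p i); case: (ltrgt0P (p i)) => pi.
  - by have := h1 i pi; rewrite ltr_pdivrMr // ; lra.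
  - by have := h2 i pi; rewrite ltr_ndivlMr //; lra.
  - by have := hu (inr (exist _ i (introT eqP pi))); rewrite /w /= -/(p i) pi mulr0 addr0.
right.
(* Each eliminated row is a combination of original rows with nonnegative weights, here collected
   per original row. *)
pose la i : R := \sum_(k : J) lam k * match k with
  | inl (i1, i2) => (val i1 == i)%:R / p (val i1) - (val i2 == i)%:R / p (val i2)
  | inr i' => (val i' == i)%:R end.
have sE (g : I -> R) : \sum_i la i * g i = \sum_(k : J) lam k * match k with
  | inl (i1, i2) => g (val i1) / p (val i1) - g (val i2) / p (val i2)
  | inr i' => g (val i') end.
  have pick (i' : I) c : \sum_i (i' == i)%:R * c * g i = c * g i'.
    rewrite (bigD1 i') //= eqxx mul1r big1 ?addr0 // => i ne.
    by rewrite eq_sym (negbTE ne) !mul0r.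
  rewrite /la; under eq_bigr do rewrite mulr_suml.
  rewrite exchange_big /=; apply: eq_bigr => -[[i1 i2]|i'] _.
    under eq_bigr do rewrite -mulrA mulrBl.
    by rewrite -mulr_sumr sumrB !pick; congr (_ * _); ring.
  under eq_bigr do rewrite -mulrA.
  rewrite -mulr_sumr; congr (_ * _).
  by rewrite -[RHS]mul1r -pick; apply: eq_bigr => i _; rewrite mulr1.
have cpos (k : J) : 0 < match k with
  | inl (i1, i2) => 1 / p (val i1) - 1 / p (val i2)
  | inr i' => 1 end :> R.
  case: k => [[[i1 p1] [i2 p2]]|_] //=.
  have : 0 < (p i1)^-1 by rewrite invr_gt0.
  have : (p i2)^-1 < 0 by rewrite invr_lt0.
  by lra.
exists la; split=> [i||j].
- apply: sumr_ge0 => -[[[i1 p1] [i2 p2]]|i'] _; rewrite mulr_ge0 //= ?ler0n //.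
  rewrite subr_ge0; apply: (@le_trans _ _ 0); last by rewrite divr_ge0 ?ler0n // ltW.
  by rewrite mulr_ge0_le0 ?ler0n // ltW // invr_lt0.
- under eq_bigr do rewrite -[la _]mulr1.
  rewrite sE lt_neqAle sumr_ge0 ?andbT; last by move=> k _; rewrite mulr_ge0 // ltW // cpos.
  apply/eqP => /esym/eqP; rewrite psumr_eq0; last by move=> k _; rewrite mulr_ge0 // ltW // cpos.
  move=> /allP h; move: lam1; rewrite big1 ?ltxx // => k _.
  have := h k (mem_index_enum k) => /=; rewrite mulf_eq0 (gt_eqF (cpos k)) orbF.
  by move=> /eqP.
- rewrite sE; case: (unliftP ord_max j) => [jd ->|->].
    have -> : lift ord_max jd = widen_ord (leqnSn d) jd.
      by apply: val_inj; rewrite /= /bump leqNgt ltn_ord.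
    by rewrite -[RHS](lamw jd); apply: eq_bigr => -[[i1 i2]|i'] _.
  apply: big1 => -[[[i1 p1] [i2 p2]]|[i' p']] _ /=; rewrite -/(p _).
    by rewrite !divff ?subrr ?mulr0 // ?(gt_eqF p1) ?(lt_eqF p2).
  by rewrite -/(p i') (eqP p') mulr0.
Qed.

End Gordan.

(** * Measurability of the events *)

Section Measurability.
Variable R : realType.

(** Strict separation of finitely many vectors is an open condition on the functional, so a rational
    one exists; the event becomes a countable union of measurable sets. *)
Lemma not_zero_in_convP d m (v : 'I_m -> 'rV[R]_d) :
  ~ zero_in_conv v <-> exists u : {ffun 'I_d -> rat}, forall i, 0 < \sum_j ratr (u j) * v i 0 j.
Proof.
split=> [nz|[u hu] [lam [lam0 [lam1 lamv]]]]; last first.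
  have : 0 < \sum_i lam i * (\sum_j ratr (u j) * v i 0 j).
    have [i0 li0] : exists i, 0 < lam i.
      apply: contrapT => nex; move: lam1; rewrite big1 => [/eqP|i _]; first by rewrite eq_sym oner_eq0.
      apply/eqP; rewrite eq_le lam0 andbT leNgt; apply/negP => h; apply: nex; by exists i.
    rewrite (bigD1 i0) //= ltr_pwDl ?mulr_gt0 // sumr_ge0 // => i _.
    by rewrite mulr_ge0 // ltW.
  have -> : \sum_i lam i * (\sum_j ratr (u j) * v i 0 j) = \sum_j ratr (u j) * (\sum_i lam i *: v i) 0 j.
    under eq_bigr do rewrite mulr_sumr.
    rewrite exchange_big /=; apply: eq_bigr => j _; rewrite summxE mulr_sumr.
    by apply: eq_bigr => i _; rewrite mxE; ring.
  by rewrite lamv big1 ?ltxx // => j _; rewrite mxE mulr0.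
have [[u hu]|[lam [lam0 lam1 lamv]]] := gordan (fun i j => v i 0 j); last first.
  exfalso; apply: nz; exists (fun i => (\sum_i lam i)^-1 * lam i); split=> [i|].
    by rewrite mulr_ge0 // invr_ge0 ltW.
  split; first by rewrite -mulr_sumr mulVf // gt_eqF.
  under eq_bigr do rewrite -scalerA; rewrite -scaler_sumr; apply/eqP; rewrite scaler_eq0; apply/orP; right; apply/eqP.
  apply/rowP => j; rewrite summxE mxE -[RHS](lamv j).
  by apply: eq_bigr => i _; rewrite mxE.
(* e is the allowed error in each coordinate of u; the summand 1 keeps the denominator positive when
   [v i] is 0. *)
have [e e0 he] : exists2 e : R, 0 < e & forall i, e * (1 + \sum_j `|v i 0 j|) < \sum_j u j * v i 0 j.
  have S0 i : 0 < 1 + \sum_j `|v i 0 j| by rewrite ltr_pwDl // sumr_ge0.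
  have [x [hx hx']] := @fin_between R unit 'I_m predT predT (fun=> 0)
    (fun i => (\sum_j u j * v i 0 j) / (1 + \sum_j `|v i 0 j|)) (fun _ i _ _ => divr_gt0 (hu i) (S0 i)).
  by exists x => [|i]; [exact: hx tt isT|rewrite -ltr_pdivlMr // hx'].
have [q hq] : exists q : 'I_d -> rat, forall j, u j - e < ratr (q j) < u j + e.
  have h j : exists q : rat, u j - e < ratr q < u j + e.
    have ue : u j - e < u j + e by lra.
    by have [q] := rat_in_itvoo ue; rewrite in_itv /=; exists q.
  by exists (fun j => xchoose (h j)) => j; exact: (xchooseP (h j)).
exists (finfun q) => i; under eq_bigr do rewrite ffunE.
have := he i.
have : 0 <= \sum_j (ratr (q j) * v i 0 j - u j * v i 0 j + e * `|v i 0 j|).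
  apply: sumr_ge0 => j _; rewrite -mulrBl.
  have : `|ratr (q j) - u j| <= e by rewrite ler_norml; have /andP[] := hq j; lra.
  move=> hqe; have := ler_wpM2r (normr_ge0 (v i 0 j)) hqe; rewrite -normrM.
  have := ler_norm (- ((ratr (q j) - u j) * v i 0 j)); rewrite normrN; lra.
rewrite big_split /= sumrB -mulr_sumr; lra.
Qed.

Context (dsp : measure_display) (T : measurableType dsp).

Lemma measurable_set_gt0 (g : T -> R) : measurable_fun setT g -> measurable [set w | 0 < g w].
Proof.
move=> mg; rewrite (_ : [set w | _] = setT `&` g @^-1` `]0, +oo[%classic); first exact: mg.
by apply/seteqP; split=> w /=; rewrite in_itv /= andbT // => -[].
Qed.

Lemma measurable_not_conv d m (v : 'I_m -> T -> 'rV[R]_d) :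
  (forall i j, measurable_fun setT (fun w => v i w 0 j)) ->
  measurable [set w | ~ zero_in_conv (v^~ w)].
Proof.
move=> mv; rewrite (_ : [set w | _] = \bigcup_(u : {ffun 'I_d -> rat})
    \bigcap_(i in [set: 'I_m]) [set w | 0 < \sum_j ratr (u j) * v i w 0 j]).
  apply: countable_bigcupT_measurable => [|u]; first exact: countableP.
  apply: fin_bigcap_measurable => [|i _]; first exact: finite_finset.
  apply: measurable_set_gt0; apply: measurable_sum => j.
  by apply: measurable_funM.
apply/seteqP; split=> w /=; first by move/not_zero_in_convP => [u hu]; exists u => // i _; exact: hu.
by move=> [u _ hu]; apply/not_zero_in_convP; exists u => i; exact: hu.
Qed.

Lemma measurable_det k (A : T -> 'M[R]_k) :
  (forall i j, measurable_fun setT (fun w => A w i j)) -> measurable_fun setT (fun w => \det (A w)).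
Proof.
move=> mA; rewrite /determinant; apply: measurable_sum => s.
by apply: measurable_funM => //; apply: measurable_prod => i _.
Qed.

Lemma measurable_any_indep d m (v : 'I_m -> T -> 'rV[R]_d) :
  (forall i j, measurable_fun setT (fun w => v i w 0 j)) ->
  measurable [set w | any_d_indep (v^~ w)].
Proof.
move=> mv; rewrite (_ : [set w | _] = \bigcap_(f in [set f : {ffun 'I_d -> 'I_m} | injective f])
    ~` [set w | \det (\matrix_(k < d) v (f k) w) = 0]).
  apply: fin_bigcap_measurable => [|f _]; first exact: finite_finset.
  apply: measurableC.
  have md : measurable_fun setT (fun w => \det (\matrix_(k < d) v (f k) w)).
    by apply: measurable_det => i j; under eq_fun do rewrite mxE; exact: mv.
  rewrite (_ : [set w | _] = setT `&` (fun w => \det (\matrix_(k < d) v (f k) w)) @^-1` [set 0]).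
    exact: md.
  by apply/seteqP; split=> w //= -[].
apply/seteqP; split=> w /=.
  move=> h f fi; have := h f fi; rewrite row_free_unit unitmxE unitfE.
  by move=> /eqP.
move=> h f fi; rewrite row_free_unit unitmxE unitfE; apply/eqP => d0.
have fi' : injective (finfun f) by move=> x y; rewrite !ffunE; apply: fi.
apply: (h (finfun f) fi'); rewrite -d0; congr (\det _).
by apply/matrixP => i j; rewrite !mxE ffunE.
Qed.

Lemma rand_mx_coord n d (X : T -> 'M[R]_(n, d)) : rand_mx X ->
  forall i j, measurable_fun setT (fun w => X w i j).
Proof.
move=> rX i j _ A mA; rewrite setTI.
have := rX [set M | A (M i j)]; apply; apply: sub_sigma_algebra.
by exists i, j, A.
Qed.

Lemma coord_rand_mx n d (X : T -> 'M[R]_(n, d)) :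
  (forall i j, measurable_fun setT (fun w => X w i j)) -> rand_mx X.
Proof.
move=> mX B; apply: (@smallest_sub _ (sigma_algebra setT) (@mx_cyl R n d)
  [set B | measurable (X @^-1` B)]).
- split=> [|A|F] /=.
  + by rewrite preimage_set0.
  + by move=> mA; rewrite setTD preimage_setC; exact: measurableC.
  + by move=> mF; rewrite preimage_bigcup; apply: bigcupT_measurable.
- move=> _ [i [j [A [mA ->]]]] /=.
  by have := mX i j measurableT A mA; rewrite setTI.
Qed.

(** Integrating a sum of indicators that is almost surely constant turns a pointwise count into an
    identity of probabilities. *)
Lemma sum_prob_indic (P : probability T R) (I : Type) (C : seq I) (A : I -> set T) (N : nat) :
  (forall c, measurable (A c)) ->
  {ae P, forall w, (\sum_(c <- C) `[< A c w >])%N = N} ->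
  \sum_(c <- C) fine (P (A c)) = N%:R.
Proof.
move=> mA aeN.
have mI c : measurable_fun setT (fun x => (\1_(A c) x)%:E : \bar R).
  by apply/measurable_EFinP; exact: measurable_indic.
have sE : (\int[P]_x (\sum_(c <- C) (\1_(A c) x)%:E) = \sum_(c <- C) P (A c))%E.
  rewrite ge0_integral_sum //; apply: eq_bigr => c _.
  by rewrite integral_indic // setIT.
have : (\int[P]_x (\sum_(c <- C) (\1_(A c) x)%:E) = \int[P]_x (N%:R%:E))%E.
  apply: ae_eq_integral => //.
    exact: emeasurable_sum.
  apply: filterS aeN => w hw _ /=.
  rewrite -hw sumEFin natr_sum; congr (_%:E); apply: eq_bigr => c _.
rewrite sE integral_cst // [X in (_ * X)%E](_ : _ = 1%E) ?mule1; last exact: probability_setT.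
move=> h; apply: EFin_inj; rewrite -h -sumEFin; apply: eq_bigr => c _.
by rewrite fineK // fin_num_measure.
Qed.

End Measurability.

Lemma cvg_natV (R : realType) : n%:R^-1 @[n --> \oo] --> (0 : R).
Proof.
rewrite -(cvg_shiftS (fun n => n%:R^-1 : R)); exact: cvg_harmonic.
Qed.

(** * The Wallis product *)

Section Wallis.
Variable R : realType.

(* An explicit antiderivative of sin ^+ n. *)
Fixpoint sin_primitive (n : nat) (x : R) : R :=
  match n with
  | 0%N => x
  | 1%N => - cos x
  | m.+2 => (m.+1%:R * sin_primitive m x - sin x ^+ m.+1 * cos x) / m.+2%:R
  end.

Lemma is_derive_sin_primitive n (x : R) : is_derive x 1 (sin_primitive n) (sin x ^+ n).
Proof.
elim/ltn_ind: n x => -[|[|n]] IH x.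
- by rewrite expr0; apply: is_derive_id.
- rewrite expr1 -[sin x]opprK; exact: is_deriveN.
have D := IH n (ltnW (ltnSn _)) x.
have -> : sin_primitive n.+2 = n.+2%:R^-1 \*: (n.+1%:R \*: sin_primitive n - (sin ^+ n.+1) * cos).
  apply/funext => y /=; rewrite !fctE /= [LHS]mulrC; congr (_ * (_ - _ * _)).
apply: is_derive_eq.
rewrite /= !scaler_nat /GRing.scale /=.
have -> : (sin ^+ n.+1) x = sin x ^+ n.+1 by rewrite !fctE.
have -> : cos x * (n.+1%:R * sin x ^+ n * cos x) = n.+1%:R * sin x ^+ n * (1 - sin x ^+ 2).
  by rewrite -[X in X - _](cos2Dsin2 x) addrK; ring.
have : (n.+2%:R : R) != 0 by rewrite pnatr_eq0.
rewrite -mulr_natl -[n.+2%:R]natr1 !exprS => n2.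
by field.
Qed.


(** The integral of sin ^+ n over [0, pi / 2], expressed by the primitive so that derivatives
    suffice. *)
Definition wallis_int n : R := sin_primitive n (pi / 2) - sin_primitive n 0.

Lemma wallis_intSS n : wallis_int n.+2 = n.+1%:R / n.+2%:R * wallis_int n.
Proof.
rewrite /wallis_int /= cos_pihalf sin0 expr0n /= mulr0 mul0r !subr0.
by rewrite -mulrBl -mulrBr mulrAC.
Qed.

Lemma wallis_int_le n : wallis_int n.+1 <= wallis_int n.
Proof.
pose f x := sin_primitive n x - sin_primitive n.+1 x.
have df (x : R) : is_derive x 1 f (sin x ^+ n - sin x ^+ n.+1).
  by apply: is_deriveB; exact: is_derive_sin_primitive.
have pi2 : 0 <= pi / 2 :> R by rewrite divr_ge0 // pi_ge0.
have : f 0 <= f (pi / 2).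
  apply: (@ger0_derive1_ndecr _ f 0 (pi / 2)) => //; last first.
    by apply: derivable_within_continuous => y _.
  move=> x; rewrite in_itv /= => /andP[x0 xp]; rewrite derive1E derive_val.
  have sx : 0 <= sin x by apply: sin_ge0_pi; rewrite (ltW x0) /=; move: pi2 xp; lra.
  by rewrite exprS subr_ge0 ler_piMl ?exprn_ge0 // sin_le1.
by rewrite /f /wallis_int; lra.
Qed.

(** This is binomial(2n, n) / 4^n, the integrating factor of the type B recurrence. *)
Fixpoint wallis (n : nat) : R := if n is m.+1 then wallis m * (m.*2.+1%:R / m.*2.+2%:R) else 1.

Lemma wallis_gt0 n : 0 < wallis n.
Proof. by elim: n => //= n IH; rewrite mulr_gt0 ?divr_gt0 ?ltr0n. Qed.

Lemma wallis_int_even n : wallis_int n.*2 = wallis n * (pi / 2).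
Proof.
elim: n => [|n IH]; first by rewrite /wallis_int /= subr0 mul1r.
by rewrite doubleS wallis_intSS IH /= mulrCA mulrA.
Qed.

Lemma wallis_int_odd n : wallis_int n.*2.+1 = (n.*2.+1%:R * wallis n)^-1.
Proof.
elim: n => [|n IH]; first by rewrite /wallis_int /= cos_pihalf cos0 mulr1 invr1 oppr0 sub0r opprK.
rewrite doubleS wallis_intSS IH /=.
have h := wallis_gt0 n; field; rewrite ?pnatr_eq0 ?gt_eqF //.
Qed.

(** The integral of even order 2n lies between its odd neighbours. Even orders contain [wallis]
    times pi / 2 and odd ones its reciprocal, so the square appears. *)
Lemma wallis_bounds n : (0 < n)%N ->
  n.*2%:R / n.*2.+1%:R <= pi * n%:R * wallis n ^+ 2 <= 1.
Proof.
case: n => // n _; have w0 := wallis_gt0 n.+1.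
have h1 := wallis_int_le n.+1.*2; have h2 := wallis_int_le n.*2.+1.
rewrite -doubleS in h2; rewrite !wallis_int_even !wallis_int_odd in h1 h2.
have e3 : n.*2.+1%:R * wallis n = n.+1.*2%:R * wallis n.+1.
  have d : (n.*2.+2%:R : R) != 0 by rewrite pnatr_eq0.
  by rewrite /= doubleS; move: (n.*2.+2%:R : R) d (n.*2.+1%:R : R) => y y0 z; field.
have e1 : n.+1.*2%:R = 2 * n.+1%:R :> R by rewrite -mul2n natrM.
have e2 : n.+1.*2.+1%:R = 2 * n.+1%:R + 1 :> R by rewrite -natr1 e1.
rewrite e3 e1 in h2; rewrite e2 in h1; rewrite e1 e2.
move: (wallis n.+1) w0 h1 h2 => w w0.
have K0 : (0 : R) < n.+1%:R by rewrite ltr0n.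
move: (n.+1%:R : R) K0 => K K0.
have K1 : 0 < 2 * K + 1 by lra.
rewrite -[((2 * K + 1) * w)^-1]div1r ler_pdivrMr ?mulr_gt0 // => h1.
rewrite -[(2 * K * w)^-1]div1r ler_pdivlMr ?mulr_gt0 // => h2.
apply/andP; split; last by apply: le_trans h2; rewrite le_eqVlt; apply/orP; left; apply/eqP; field.
rewrite ler_pdivrMr //.
have -> : pi * K * w ^+ 2 * (2 * K + 1) = 2 * K * (w * (pi / 2) * ((2 * K + 1) * w)) by field.
by rewrite ler_peMr // mulr_ge0 // ltW.
Qed.

Lemma cvg_wallis : wallis n * Num.sqrt (pi * n%:R) @[n --> \oo] --> (1 : R).
Proof.
have h1 : 1 - n%:R^-1 @[n --> \oo] --> (1 : R).
  by rewrite -[X in _ --> X]subr0; apply: cvgB; [exact: cvg_cst|exact: cvg_natV].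
apply: (squeeze_cvgr (f := fun n => 1 - n%:R^-1) (h := fun=> 1)); [|exact: h1|exact: cvg_cst].
near=> n; have n0 : (0 < n)%N by near: n; exists 1%N.
have /andP[] := wallis_bounds n0.
have w0 := wallis_gt0 n.
have s0 : 0 <= Num.sqrt (pi * n%:R : R) by exact: sqrtr_ge0.
have -> : pi * n%:R * wallis n ^+ 2 = (wallis n * Num.sqrt (pi * n%:R)) ^+ 2.
  rewrite exprMn sqr_sqrtr; first by rewrite mulrC.
  by rewrite mulr_ge0 ?pi_ge0 ?ler0n.
have : 0 <= wallis n * Num.sqrt (pi * n%:R) by rewrite mulr_ge0 // ltW.
set x := wallis n * _ => x0 h2 h3.
have n0' : (0 : R) < n%:R by rewrite ltr0n.
have h4 : 1 - n%:R^-1 <= n.*2%:R / n.*2.+1%:R :> R.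
  rewrite ler_pdivlMr ?ltr0n // -natr1 -muln2 natrM.
  have -> : (1 - n%:R^-1) * (n%:R * 2 + 1) = n%:R * 2 - 1 - n%:R^-1 :> R by field; rewrite gt_eqF.
  have : 0 < n%:R^-1 :> R by rewrite invr_gt0.
  lra.
have x1 : x <= 1 by rewrite -(@ler_pXn2r _ 2) ?nnegrE ?ler01 // expr1n.
(* For x in [0, 1], x lies between its square and 1, so the bounds on the square suffice for the
   limit of x. *)
have x2 : x ^+ 2 <= x by rewrite expr2 ler_piMl.
by rewrite x1 andbT; apply: le_trans x2; apply: le_trans h2; exact: h4.
Unshelve. all: by end_near. Qed.

End Wallis.

(** * Stolz-Cesaro and powers of the logarithm *)

Section Stolz.
Variable R : realType.
Implicit Types (u v a b : nat -> R).

Lemma stolz_cesaro u b (l : R) N : (forall n, (N <= n)%N -> b n < b n.+1) ->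
  b n @[n --> \oo] --> +oo ->
  (u n.+1 - u n) / (b n.+1 - b n) @[n --> \oo] --> l -> u n / b n @[n --> \oo] --> l.
Proof.
move=> bS boo /cvgrPdist_le du; apply/cvgrPdist_le => e e0.
have [M1 _ hM1] := du _ (divr_gt0 e0 (ltr0Sn R 1)).
have [M2 _ hM2] := (cvgryPge _).1 boo 0.
pose M := maxn N (maxn M1 M2).
(* The increments telescope from M on, each contributing at most e / 2 times the growth of b. *)
have dM n : (M <= n)%N -> `|u n - l * b n| <= `|u M - l * b M| + e / 2 * (b n - b M).
  elim: n => [|n IH]; first by rewrite leqn0 => /eqP <-; rewrite subrr mulr0 addr0.
  rewrite leq_eqVlt => /orP[/eqP <-|]; first by rewrite subrr mulr0 addr0.
  rewrite ltnS => Mn; have {}IH := IH Mn.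
  have [Nn M1n _] : [/\ (N <= n)%N, (M1 <= n)%N & (M2 <= n)%N].
    by move: Mn; rewrite !geq_max => /and3P[].
  have db : 0 < b n.+1 - b n by rewrite subr_gt0 bS.
  have /= := hM1 n M1n.
  have -> : l - (u n.+1 - u n) / (b n.+1 - b n) = - ((u n.+1 - l * b n.+1) - (u n - l * b n)) / (b n.+1 - b n).
    by field; rewrite gt_eqF.
  rewrite normrM normrN normfV (gtr0_norm db) ler_pdivrMr // => h.
  have := ler_normD ((u n.+1 - l * b n.+1) - (u n - l * b n)) (u n - l * b n); rewrite subrK.
  lra.
(* From here on the fixed initial error is at most e / 2 times [b n]; the 1 makes [b n] positive. *)
have [M3 _ hM3] := (cvgryPge _).1 boo (2 * `|u M - l * b M| / e + 1).
exists (maxn M M3) => // n /=; rewrite geq_max => /andP[Mn M3n].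
have := hM3 n M3n; rewrite /= => bn.
have c0 : 0 <= 2 * `|u M - l * b M| / e by rewrite divr_ge0 ?mulr_ge0 // ltW.
have b0 : 0 < b n by lra.
have bM0 : 0 <= b M by apply: hM2; rewrite /= /M !leq_max leqnn !orbT.
have -> : l - u n / b n = - (u n - l * b n) / b n by field; rewrite gt_eqF.
rewrite normrM normrN normfV (gtr0_norm b0) ler_pdivrMr //.
have := dM n Mn.
have : 2 * `|u M - l * b M| <= e * b n.
  have : 2 * `|u M - l * b M| / e <= b n by lra.
  by rewrite ler_pdivrMr // [b n * e]mulrC.
by move: (`|u M - l * b M|) (`|u n - l * b n|) => C D h1 h2; nra.
Qed.

Local Notation L n := (ln (n%:R : R)).

Lemma ln_nat_gt0 n : (2 <= n)%N -> 0 < L n.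
Proof. by move=> n2; rewrite ln_gt0 // ltr1n. Qed.

Lemma lnS_bounds n : (1 <= n)%N -> n%:R / n.+1%:R <= n%:R * (L n.+1 - L n) <= 1.
Proof.
move=> n1; have n0 : (0 : R) < n%:R by rewrite ltr0n.
have n0' : (0 : R) < n.+1%:R by rewrite ltr0n.
apply/andP; split.
  rewrite ler_pM2l //.
  have := @le_ln1Dx R (- n.+1%:R^-1); rewrite ltrN2 invf_lt1 // ltr1n ltnS => /(_ n1).
  have -> : 1 - n.+1%:R^-1 = n%:R / n.+1%:R :> R by rewrite -natr1; field; rewrite natr1 gt_eqF.
  by rewrite ln_div ?posrE // lerNr opprB.
have := @le_ln1Dx R n%:R^-1; rewrite (lt_trans (ltrN10 R)) ?invr_gt0 // => /(_ isT).
have -> : 1 + n%:R^-1 = n.+1%:R / n%:R :> R by rewrite -natr1; field; rewrite gt_eqF.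
rewrite ln_div ?posrE // => h.
by rewrite -[X in _ <= X](mulfV (lt0r_neq0 n0)) ler_pM2l.
Qed.

Lemma cvg_lnS : n%:R * (L n.+1 - L n) @[n --> \oo] --> (1 : R).
Proof.
have h1 : 1 - n%:R^-1 @[n --> \oo] --> (1 : R).
  by rewrite -[X in _ --> X]subr0; apply: cvgB; [exact: cvg_cst|exact: cvg_natV].
apply: (squeeze_cvgr (f := fun n => 1 - n%:R^-1) (h := fun=> 1)); [|exact: h1|exact: cvg_cst].
near=> n; have n0 : (0 < n)%N by near: n; exists 1%N.
have n0' : (0 : R) < n%:R by rewrite ltr0n.
have /andP[h2 ->] := lnS_bounds n0; rewrite andbT; apply: le_trans h2.
rewrite ler_pdivlMr ?ltr0n // -natr1.
have -> : (1 - n%:R^-1) * (n%:R + 1) = n%:R - n%:R^-1 :> R by field; rewrite gt_eqF.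
by rewrite gerBl invr_ge0 ltW.
Unshelve. all: by end_near. Qed.

Lemma cvg_ln_ratio : L n.+1 / L n @[n --> \oo] --> (1 : R).
Proof.
have h1 : 1 + n%:R^-1 * (L 2)^-1 @[n --> \oo] --> (1 : R).
  rewrite -[X in _ --> X](addr0 1) -[X in 1 + X](mul0r (L 2)^-1).
  apply: cvgD; first exact: cvg_cst.
  by apply: cvgM; [exact: cvg_natV|exact: cvg_cst].
apply: (squeeze_cvgr (f := fun=> 1) (h := fun n => 1 + n%:R^-1 * (L 2)^-1)); [|exact: cvg_cst|exact: h1].
near=> n; have n2 : (2 <= n)%N by near: n; exists 2%N.
have n0 : (0 : R) < n%:R by rewrite ltr0n (ltn_trans _ n2).
have Ln0 := ln_nat_gt0 n2; have L20 := @ln_nat_gt0 2 isT.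
have LE : L 2 <= L n by rewrite ler_ln ?posrE ?ler_nat.
have LS : L n <= L n.+1 by rewrite ler_ln ?posrE // ?ltr0n // ler_nat.
rewrite ler_pdivlMr // mul1r LS /= ler_pdivrMr //.
have /andP[_ h] := lnS_bounds (ltnW n2).
have : L n.+1 - L n <= n%:R^-1 by rewrite -[X in _ <= X]mulr1 ler_pdivlMl.
have : 1 <= (L 2)^-1 * L n by rewrite mulrC ler_pdivlMr ?mul1r.
have : 0 < n%:R^-1 :> R by rewrite invr_gt0.
by move: (n%:R^-1) ((L 2)^-1) (L n) (L n.+1) => x y A B x0 h2 h3; nra.
Unshelve. all: by end_near. Qed.

Lemma cvg_ln_nat : L n @[n --> \oo] --> +oo.
Proof.
apply/cvgryPge => A; have [M _ hM] := (cvgryPge _).1 (@cvgr_idn R) (expR A).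
exists (maxn 1 M) => // n /=; rewrite geq_max => /andP[n1 /hM /= h].
by rewrite -[A]expRK ler_ln // posrE ?expR_gt0 // ltr0n.
Qed.

Lemma cvg_exp_seq u (l : R) k : u n @[n --> \oo] --> l -> u n ^+ k @[n --> \oo] --> l ^+ k.
Proof.
move=> ul; elim: k => [|k IH]; first by rewrite expr0; apply: cvg_cst.
rewrite exprS; under eq_fun do rewrite exprS.
exact: cvgM.
Qed.

Lemma cvg_sum_ones (I : Type) (r : seq I) (f : I -> nat -> R) :
  (forall i, f i n @[n --> \oo] --> (1 : R)) ->
  \sum_(i <- r) f i n @[n --> \oo] --> ((size r)%:R : R).
Proof.
move=> fi; elim: r => [|i r IH]; first by under eq_fun do rewrite big_nil; apply: cvg_cst.
under eq_fun do rewrite big_cons.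
by rewrite /= -add1n natrD; apply: cvgD.
Qed.

(** Discrete integration of al c (log n)^k / n. It is compared with L ^+ k.+1, whose increment is
    [L n.+1 - L n] times k + 1 products, each asymptotic to [L n ^+ k]. *)
Lemma cvg_log_step u v a k (c al : R) N :
  v n / L n ^+ k @[n --> \oo] --> c -> n%:R * a n @[n --> \oo] --> al ->
  (forall n, (N <= n)%N -> u n.+1 = u n + v n * a n) ->
  u n / L n ^+ k.+1 @[n --> \oo] --> al * c / k.+1%:R.
Proof.
move=> vc aal uS; apply: (@stolz_cesaro _ _ _ 1%N).
- move=> n n1; rewrite ltrXn2r //; last by rewrite ltr_ln ?posrE ?ltr0n // ltr_nat.
  by rewrite ln_ge0 // ler1n.
- apply/cvgryPge => A; have [M _ hM] := (cvgryPge _).1 cvg_ln_nat (Num.max 1 A).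
  exists M => // n /hM /=; rewrite ge_max => /andP[L1 LA].
  by rewrite exprS (le_trans LA) // ler_peMr ?exprn_ege1 // (le_trans ler01).
pose S n := \sum_(i < k.+1) (L n.+1 / L n) ^+ (k - i)%N.
have cS : S n @[n --> \oo] --> (k.+1%:R : R).
  have e : size (index_enum 'I_k.+1) = k.+1 by rewrite /index_enum -enumT size_enum_ord.
  rewrite -e /S; apply: (cvg_sum_ones (f := fun (i : 'I_k.+1) n => (L n.+1 / L n) ^+ (k - i)%N)) => i.
  by rewrite -[X in _ --> X](expr1n R (k - i)); apply: cvg_exp_seq; exact: cvg_ln_ratio.
have cT : (n%:R * a n) * (v n / L n ^+ k) / ((n%:R * (L n.+1 - L n)) * S n) @[n --> \oo] --> al * c / k.+1%:R.
  apply: cvgM; first exact: cvgM.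
  rewrite -[k.+1%:R]mul1r; apply: cvgV; first by rewrite mul1r pnatr_eq0.
  by apply: cvgM => //; exact: cvg_lnS.
apply: cvg_trans cT; apply: near_eq_cvg; near=> n.
have n2 : (2 <= n)%N by near: n; exists 2%N.
have Nn : (N <= n)%N by near: n; exists N.
have n0 : (n%:R : R) != 0 by rewrite pnatr_eq0 -lt0n (ltn_trans _ n2).
have Ln0 : L n != 0 by rewrite gt_eqF // ln_nat_gt0.
have dL : L n.+1 - L n != 0 by rewrite subr_eq0 gt_eqF // ltr_ln ?posrE ?ltr0n ?ltr_nat // (ltn_trans _ n2).
rewrite uS // addrAC subrr add0r subrXX.
have -> : \sum_(i < k.+1) L n.+1 ^+ (k.+1.-1 - i) * L n ^+ i = S n * L n ^+ k.
  rewrite /S mulr_suml; apply: eq_bigr => i _.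
  have -> : L n ^+ k = L n ^+ (k - i) * L n ^+ i by rewrite -exprD subnK // -ltnS.
  rewrite expr_div_n /=.
  by field; rewrite expf_neq0.
have S0 : S n != 0.
  rewrite gt_eqF // /S big_ord_recr /= subnn expr0 ltr_wpDl //.
  apply: sumr_ge0 => i _; rewrite exprn_ge0 // divr_ge0 // ln_ge0 // ler1n //.
  exact: ltnW.
by field; rewrite S0 dL n0 expf_neq0.
Unshelve. all: by end_near. Qed.

End Stolz.

(** * Asymptotics of the recurrence *)

Section Rates.
Variable R : realType.

(** The fraction of chambers that are missed; [prob_exchangeable] identifies it with the probability
    in types A and B. *)
Definition hull_free b n d : R := 1 - (nmeet b n d)%:R / (sp_total b n)%:R.

Lemma sp_total_gt0 b n : (0 < sp_total b n)%N.
Proof. by elim: n => //= n IH; rewrite muln_gt0. Qed.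

Lemma hull_free0 b n : hull_free b n 0 = 0.
Proof.
rewrite /hull_free (_ : nmeet b n 0 = sp_total b n); last by case: n.
by rewrite divff ?subrr // pnatr_eq0 -lt0n sp_total_gt0.
Qed.

Lemma hull_free_min b d : hull_free b (d.+1 + ~~ b) d.+1 = 1.
Proof. by rewrite /hull_free addSn /= leqnn mul0r subr0. Qed.

Lemma hull_freeS b n d : (d.+1 + ~~ b <= n)%N ->
  hull_free b n.+1 d.+1 =
  (hull_free b n d + (slots b n)%:R * hull_free b n d.+1) / (slots b n).+1%:R.
Proof.
move=> nd; rewrite /hull_free /= leqNgt ltnS nd /= natrD !natrM.
have : ((sp_total b n)%:R : R) != 0 by rewrite pnatr_eq0 -lt0n sp_total_gt0.
have : ((slots b n)%:R + 1 : R) != 0 by rewrite natr1 pnatr_eq0.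
rewrite -!natr1; move: (_%:R : R) => t.
move: ((sp_total b n)%:R : R) ((nmeet b n d)%:R : R) ((nmeet b n d.+1)%:R : R) => T x y t0 T0.
by field; rewrite t0 T0.
Qed.

(** Division by the integrating factor w makes the recurrence additive, each dimension being driven
    by the previous one through 1 / slots, as in [cvg_log_step]. In dimension 1 the quotient is
    constantly 1 / w = 2, its value at n = 1 + ~~ b. *)
Lemma cvg_hull_free b (w : nat -> R) (al : R) d :
  (forall n, (0 < n)%N -> 0 < w n) ->
  (forall n, (0 < n)%N -> w n.+1 = w n * ((slots b n)%:R / (slots b n).+1%:R)) ->
  w (1 + ~~ b)%N = 2^-1 ->
  n%:R * (slots b n)%:R^-1 @[n --> \oo] --> al ->
  hull_free b n d.+1 / w n / ln n%:R ^+ d @[n --> \oo] --> 2 * al ^+ d / d`!%:R.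
Proof.
move=> w0 wS w1 cal.
have c0 n : (0 < n)%N -> (slots b n)%:R != 0 :> R.
  by move=> n0; rewrite pnatr_eq0 /slots; case: b {w1 cal wS}; lia.
have step d' n : (d'.+1 + ~~ b <= n)%N -> hull_free b n.+1 d'.+1 / w n.+1 =
    hull_free b n d'.+1 / w n + hull_free b n d' / w n * (slots b n)%:R^-1.
  move=> nd; have n0 : (0 < n)%N by apply: leq_trans nd; rewrite addSn.
  rewrite hull_freeS // wS //.
  have := c0 n n0; have := w0 n n0.
  have : ((slots b n)%:R + 1 : R) != 0 by rewrite natr1 pnatr_eq0.
  rewrite -!natr1; move: (hull_free b n _) (hull_free b n _) (w n) ((slots b n)%:R : R) => h1 h2 z c k1 z0 k0.
  by field; rewrite k0 k1 gt_eqF.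
elim: d => [|d IH].
  rewrite expr0 mulr1 fact0 divr1.
  apply: cvg_near_cst; near=> n.
  have : (1 + ~~ b <= n)%N by near: n; exists (1 + ~~ b)%N.
  elim: (n) => [|m IHm]; first by rewrite addSn.
  rewrite leq_eqVlt => /orP[/eqP <-|].
    by rewrite (hull_free_min b 0) w1 expr0 divr1 div1r invrK.
  rewrite ltnS => nm; rewrite step // hull_free0 mul0r mul0r addr0; exact: IHm.
have -> : 2 * al ^+ d.+1 / (d.+1)`!%:R = al * (2 * al ^+ d / d`!%:R) / d.+1%:R :> R.
  have : (d.+1%:R : R) != 0 by rewrite pnatr_eq0.
  have : (d`!%:R : R) != 0 by rewrite pnatr_eq0 -lt0n fact_gt0.
  rewrite factS natrM exprS; move: (d.+1%:R : R) (d`!%:R : R) (al ^+ d) => x y z y0 x0.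
  by field; rewrite x0 y0.
apply: (cvg_log_step IH cal (N := (d.+2 + ~~ b)%N)) => n nd.
exact: step.
Unshelve. all: by end_near. Qed.

Lemma cvg_rateA d : hull_free false n d.+1 / rate R TypeA d.+1 n @[n --> \oo] --> (1 : R).
Proof.
have := @cvg_hull_free false (fun n => n%:R^-1) 1 d.
have h1 n : (0 < n)%N -> 0 < (n%:R^-1 : R) by move=> n0; rewrite invr_gt0 ltr0n.
have h2 n : (0 < n)%N -> n.+1%:R^-1 = n%:R^-1 * (n%:R / n.+1%:R) :> R.
  by move=> n0; rewrite mulrA mulVf ?mul1r // pnatr_eq0 -lt0n.
have h3 : n%:R * (slots false n)%:R^-1 @[n --> \oo] --> (1 : R).
  apply: cvg_near_cst; near=> n.
  by rewrite /= mulfV // pnatr_eq0 -lt0n; near: n; exists 1%N.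
move=> /(_ h1 h2 erefl h3); rewrite expr1n mulr1 => h.
have d0 : (d`!%:R : R) != 0 by rewrite pnatr_eq0 -lt0n fact_gt0.
have cv : hull_free false n d.+1 / n%:R^-1 / ln n%:R ^+ d * (d`!%:R / 2) @[n --> \oo] --> (1 : R).
  rewrite [X in _ --> X](_ : 1 = 2 / d`!%:R * (d`!%:R / 2)); last by field.
  by apply: cvgM => //; exact: cvg_cst.
apply: cvg_trans cv; apply: near_eq_cvg; near=> n.
have n2 : (2 <= n)%N by near: n; exists 2%N.
have n0 : (n%:R : R) != 0 by rewrite pnatr_eq0 -lt0n (ltn_trans _ n2).
have L0 : ln (n%:R : R) ^+ d != 0 by rewrite expf_neq0 // gt_eqF // ln_nat_gt0.
by rewrite /rate /= ?fctE; field; rewrite d0 n0 L0.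
Unshelve. all: by end_near. Qed.

(** Here al = 1 / 2, since slots grow like 2 n; so the constant is 2 / 2^d, and 0 < d lets it be
    written with the exponent d - 1. *)
Lemma cvg_rateB d : (0 < d)%N ->
  hull_free true n d.+1 / rate R TypeB d.+1 n @[n --> \oo] --> (1 : R).
Proof.
move=> d1.
have h2 n : (0 < n)%N -> wallis R n.+1 = wallis R n * ((slots true n)%:R / (slots true n).+1%:R) by [].
have w1 : wallis R (1 + ~~ true) = 2^-1 by rewrite /= mul1r div1r.
have h3 : n%:R * (slots true n)%:R^-1 @[n --> \oo] --> (2^-1 : R).
  have h4 : (2 + n%:R^-1)^-1 @[n --> \oo] --> (2^-1 : R).
    apply: cvgV; first by rewrite pnatr_eq0.
    rewrite -[X in _ --> X]addr0; apply: cvgD; [exact: cvg_cst|exact: cvg_natV].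
  apply: cvg_trans h4; apply: near_eq_cvg; near=> n.
  have n0 : (0 : R) < n%:R by rewrite ltr0n; near: n; exists 1%N.
  have -> : (slots true n)%:R = 2 * n%:R + 1 :> R by rewrite /slots /= -natr1 -mul2n natrM.
  field.
  by rewrite !gt_eqF // ?addr_gt0 // ?mulr_gt0.
have := cvg_hull_free (d := d) (fun n _ => wallis_gt0 R n) h2 w1 h3.
have d0 : (d`!%:R : R) != 0 by rewrite pnatr_eq0 -lt0n fact_gt0.
move=> h.
have cv : hull_free true n d.+1 / wallis R n / ln n%:R ^+ d * (wallis R n * Num.sqrt (pi * n%:R)) *
    (2 ^+ (d - 1) * d`!%:R) @[n --> \oo] --> (1 : R).
  rewrite [X in _ --> X](_ : 1 = 2 * 2^-1 ^+ d / d`!%:R * 1 * (2 ^+ (d - 1) * d`!%:R)); last first.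
    case: d d1 {h} d0 => // d _ d0; rewrite subn1 /= exprVn exprS.
    by field; rewrite d0 expf_neq0 // pnatr_eq0.
  by apply: cvgM; [apply: cvgM => //; exact: cvg_wallis|exact: cvg_cst].
apply: cvg_trans cv; apply: near_eq_cvg; near=> n.
have n2 : (2 <= n)%N by near: n; exists 2%N.
have n0 : (0 : R) < n%:R by rewrite ltr0n (ltn_trans _ n2).
have L0 : ln (n%:R : R) ^+ d != 0 by rewrite expf_neq0 // gt_eqF // ln_nat_gt0.
have w0 : wallis R n != 0 by rewrite gt_eqF // wallis_gt0.
have s0 : Num.sqrt (pi * n%:R : R) != 0 by rewrite gt_eqF // sqrtr_gt0 mulr_gt0 // pi_gt0.
rewrite /rate /= ?fctE subSS.
by field; rewrite d0 s0 w0 L0 expf_neq0 // pnatr_eq0.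
Unshelve. all: by end_near. Qed.

Lemma cvg_sqrt_ratio : Num.sqrt (pi * n.+1%:R) / Num.sqrt (pi * n%:R) @[n --> \oo] --> (1 : R).
Proof.
have h1 : 1 + n%:R^-1 @[n --> \oo] --> (1 : R).
  by rewrite -[X in _ --> X]addr0; apply: cvgD; [exact: cvg_cst|exact: cvg_natV].
apply: (squeeze_cvgr (f := fun=> 1) (h := fun n => 1 + n%:R^-1)); [|exact: cvg_cst|exact: h1].
near=> n; have n0 : (0 : R) < n%:R by rewrite ltr0n; near: n; exists 1%N.
have s0 : 0 < Num.sqrt (pi * n%:R : R) by rewrite sqrtr_gt0 mulr_gt0 // pi_gt0.
have p0 : 0 < pi :> R := pi_gt0 R.
have q0 : 0 <= (n%:R^-1 : R) by rewrite invr_ge0 ltW.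
rewrite ler_pdivlMr // mul1r ler_wsqrtr ?ler_pM2l // ?ler_nat //=.
rewrite ler_pdivrMr // -[X in _ <= X * _]ger0_norm ?addr_ge0 // -sqrtr_sqr -sqrtrM ?sqr_ge0 //.
rewrite ler_wsqrtr // mulrCA ler_pM2l //.
have -> : (1 + n%:R^-1) ^+ 2 * n%:R = n.+1%:R + (1 + n%:R^-1) :> R.
  by rewrite -natr1; field; rewrite gt_eqF.
by rewrite lerDl addr_ge0.
Unshelve. all: by end_near. Qed.

(** Consecutive values of the type B rate have ratio tending to 1, so the combination 2 P_B(n) -
    P_B(n - 1) inherits that rate. *)
Lemma cvg_rateD d : (0 < d)%N ->
  (2 * hull_free true n d.+1 - hull_free true n.-1 d.+1) / rate R TypeD d.+1 n
    @[n --> \oo] --> (1 : R).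
Proof.
move=> d1; have hB := cvg_rateB d1.
have hBS : hull_free true n.+1 d.+1 / rate R TypeB d.+1 n.+1 @[n --> \oo] --> (1 : R).
  by rewrite (cvg_shiftS (fun n => hull_free true n d.+1 / rate R TypeB d.+1 n)).
rewrite -(cvg_shiftS (fun n => (2 * hull_free true n d.+1 - hull_free true n.-1 d.+1) / rate R TypeD d.+1 n)).
have hL : ln n%:R / ln n.+1%:R @[n --> \oo] --> (1 : R).
  have cv : (ln n.+1%:R / ln n%:R)^-1 @[n --> \oo] --> (1 : R).
    by rewrite -[X in _ --> X]invr1; apply: cvgV; [exact: oner_neq0|exact: cvg_ln_ratio].
  by apply: cvg_trans cv; apply: near_eq_cvg; near=> n; rewrite invf_div.
have cv : 2 * (hull_free true n.+1 d.+1 / rate R TypeB d.+1 n.+1) -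
    hull_free true n d.+1 / rate R TypeB d.+1 n *
    ((ln n%:R / ln n.+1%:R) ^+ d * (Num.sqrt (pi * n.+1%:R) / Num.sqrt (pi * n%:R)))
    @[n --> \oo] --> (1 : R).
  rewrite [X in _ --> X](_ : 1 = 2 * 1 - 1 * (1 ^+ d * 1)); last by rewrite expr1n; ring.
  apply: cvgB; first by apply: cvgM => //; exact: cvg_cst.
  by apply: cvgM => //; apply: cvgM; [exact: cvg_exp_seq|exact: cvg_sqrt_ratio].
apply: cvg_trans cv; apply: near_eq_cvg; near=> n.
have n2 : (2 <= n)%N by near: n; exists 2%N.
have n0 : (0 : R) < n%:R by rewrite ltr0n (ltn_trans _ n2).
have L0 : ln (n%:R : R) != 0 by rewrite gt_eqF // ln_nat_gt0.
have L1 : ln (n.+1%:R : R) != 0 by rewrite gt_eqF // ln_nat_gt0 // ltnW.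
have s0 : Num.sqrt (pi * n%:R : R) != 0 by rewrite gt_eqF // sqrtr_gt0 mulr_gt0 // pi_gt0.
have s1 : Num.sqrt (pi * n.+1%:R : R) != 0 by rewrite gt_eqF // sqrtr_gt0 mulr_gt0 ?pi_gt0 // ltr0n.
have d0 : (d`!%:R : R) != 0 by rewrite pnatr_eq0 -lt0n fact_gt0.
have t0 : (2 ^+ (d - 1) : R) != 0 by rewrite expf_neq0 // pnatr_eq0.
rewrite /rate /= ?fctE /= subSS expr_div_n.
have e0 := expf_neq0 d L0; have e1 := expf_neq0 d L1.
move: (ln n%:R ^+ d) (ln n.+1%:R ^+ d) (Num.sqrt (pi * n%:R)) (Num.sqrt (pi * n.+1%:R)) (d`!%:R : R) (2 ^+ (d - 1) : R) e0 e1 s0 s1 d0 t0 => A B C D E F e0 e1 s0 s1 d0 t0.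
by field; rewrite e0 e1 s0 s1 d0 t0.
Unshelve. all: by end_near. Qed.

End Rates.

(** * Symbolic codes of signed permutations *)

Section InsertionPerm.
Variables (T U : eqType) (b : bool) (neg : T -> T) (f : T -> U).
Hypothesis fN : forall x, b -> f (neg x) = f x.

(** f forgets what [neg] changes: the index projection when signs occur, the identity when they do
    not. *)
Lemma ins_perm x y z : z \in ins b neg x y -> perm_eq (map f z) (f x :: map f y).
Proof.
elim: y z => [|a y IH] z /=.
  by case: b fN => fN'; rewrite !inE; [case/orP|]; move=> /eqP -> /=; rewrite ?fN'.
rewrite inE mem_cat => /or3P[/eqP -> //||/mapP[z' /IH h -> /=]].
  by case: b fN => // fN'; rewrite inE => /eqP -> /=; rewrite fN'.
have := h; rewrite -(perm_cons (f a)) => /perm_trans; apply.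
by rewrite (perm_catCA [:: f a] [:: f x] (map f y)).
Qed.

Lemma sp_perm s y : y \in sp b neg s -> perm_eq (map f y) (map f s).
Proof.
elim: s y => [|x s IH] y /=; first by rewrite inE => /eqP ->.
case/flattenP => l /mapP[z /IH h ->] /ins_perm h'.
by rewrite (perm_trans h') //= perm_cons.
Qed.

End InsertionPerm.

Lemma map_nth_enum (T : Type) n (c : seq T) (x : 'I_n -> T) : size c = n ->
  [seq nth (x i) c i | i <- enum 'I_n] = c.
Proof.
case: n x => [|n] x sc; first by rewrite (size0nil sc); case: (enum _) (size_enum_ord 0).
apply: (@eq_from_nth _ (x ord0)); first by rewrite size_map -cardE card_ord sc.
move=> k; rewrite size_map size_enum_ord => kn; rewrite (nth_map (Ordinal kn)) ?size_enum_ord //.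
rewrite (_ : nth _ (enum _) k = Ordinal kn); last first.
  by apply: val_inj; rewrite /= nth_enum_ord.
by apply: set_nth_default; rewrite sc.
Qed.

Section Codes.
Variable n : nat.

(* (e, i) stands for the step (-1)^e xi_i. *)
Definition signed_index : Type := (bool * 'I_n)%type.
Definition code_neg (c : signed_index) : signed_index := (~~ c.1, c.2).
(** A list independent of the outcome, so that each of its entries defines an event. *)
Definition codes b : seq (seq signed_index) := sp b code_neg [seq (false, i) | i <- enum 'I_n].
Definition act_code (V : zmodType) (y : 'I_n -> V) (c : signed_index) : V := if c.1 then - y c.2 else y c.2.
Definition act_codes (V : zmodType) (y : 'I_n -> V) (c : seq signed_index) (i : 'I_n) : V :=
  act_code y (nth (false, i) c i).

Lemma size_codes b c : c \in codes b -> size c = n.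
Proof. by move=> /sp_size ->; rewrite size_map -cardE card_ord. Qed.

Lemma size_all_codes b : size (codes b) = sp_total b n.
Proof. by rewrite /codes size_sp size_map -cardE card_ord. Qed.

Lemma codesP b c : c \in codes b -> exists (s : 'S_n) (e : 'I_n -> bool),
  [/\ forall i, nth (false, i) c i = (e i, s i), (e =1 fun=> false) \/ b & c = [seq (e i, s i) | i <- enum 'I_n]].
Proof.
move=> cC; have sc := size_codes cC.
have p2 := @sp_perm _ _ b code_neg (@snd bool 'I_n) (fun _ _ => erefl) _ _ cC.
rewrite -map_comp (eq_map (g := id)) // map_id in p2.
have uc : uniq (map snd c) by rewrite (perm_uniq p2) enum_uniq.
pose f i : 'I_n := (nth (false, i) c i).2.
have fi : injective f.
  move=> i j; rewrite /f -(nth_map _ i) ?sc ?ltn_ord // -(nth_map _ i snd (n := j)) ?sc ?ltn_ord // => h.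
  apply: val_inj; apply/eqP; rewrite -(nth_uniq i _ _ uc) ?size_map ?sc ?ltn_ord //.
  apply/eqP; rewrite h; by apply: set_nth_default; rewrite size_map sc ltn_ord.
have nE i : nth (false, i) c i = ((nth (false, i) c i).1, perm fi i).
  by rewrite permE /f -surjective_pairing.
exists (perm fi), (fun i => (nth (false, i) c i).1); split=> //.
  case: (boolP b) => hb; [by right|left] => i.
  have hN (x : signed_index) : b -> code_neg x = x by rewrite (negbTE hb).
  have := @sp_perm _ _ b code_neg id hN _ _ cC; rewrite !map_id => /perm_mem/(_ (nth (false, i) c i)).
  by rewrite mem_nth ?sc // => /esym/mapP[k _ ->].
rewrite -[LHS](map_nth_enum (fun i => (false, i)) sc).
by apply: eq_map => i; exact: nE.
Qed.

Lemma map_act_codes (V : zmodType) (y : 'I_n -> V) b c : c \in codes b ->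
  map (act_code y) c = [seq act_codes y c i | i <- enum 'I_n].
Proof.
move=> /codesP[s [e [nE _ cE]]]; rewrite {1}cE -map_comp; apply: eq_map => i /=.
by rewrite /act_codes nE.
Qed.

Lemma sp_steps (V : zmodType) (y : 'I_n -> V) b :
  sp b -%R [seq y i | i <- enum 'I_n] = [seq [seq act_codes y c i | i <- enum 'I_n] | c <- codes b].
Proof.
have yE : map (act_code y) [seq (false, i) | i <- enum 'I_n] = [seq y i | i <- enum 'I_n].
  by rewrite -map_comp; apply: eq_map.
rewrite -yE -(@map_sp _ _ b code_neg -%R); last by move=> [[] i]; rewrite /act_code /= ?opprK.
by apply/eq_in_map => c cC; apply: map_act_codes cC.
Qed.

End Codes.

(** * Random walks as matrices, and transfer of laws *)

Section Counting.
Variables (R : realType) (dsp : measure_display) (T : measurableType dsp) (P : probability T R).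
Variables (n d : nat) (xi : 'I_n -> T -> 'rV[R]_d).
Hypothesis rxi : forall i, rand_mx (xi i).

Lemma act_codes_ps (c : seq (signed_index n)) (s : 'S_n) (e : 'I_n -> bool) w : (forall i, nth (false, i) c i = (e i, s i)) ->
  (fun i => row i (tup_ps xi s e w)) = act_codes (xi^~ w) c.
Proof.
move=> h; apply/funext => i; apply/rowP => j; rewrite !mxE /act_codes h /act_code /=.
by case: (e i); rewrite ?expr0 ?expr1 ?mul1r ?mulN1r ?mxE.
Qed.

Lemma measurable_xi i j : measurable_fun setT (fun w => xi i w 0 j).
Proof. exact: (rand_mx_coord (rxi i)). Qed.

Lemma rand_tup : rand_mx (tup xi).
Proof.
by apply: coord_rand_mx => i j; under eq_fun do rewrite mxE; exact: measurable_xi.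
Qed.

Lemma rand_tup_ps s e : rand_mx (tup_ps xi s e).
Proof.
apply: coord_rand_mx => i j; under eq_fun do rewrite mxE.
by apply: measurable_funM => //; exact: measurable_xi.
Qed.

Lemma measurable_walk (S : measurableType dsp) (y : 'I_n -> S -> 'rV[R]_d) k j :
  (forall i j, measurable_fun setT (fun w => y i w 0 j)) ->
  measurable_fun setT (fun w => walk_sum (y^~ w) k 0 j).
Proof.
move=> my; rewrite (_ : (fun w => _) = fun w => \sum_(i < n) (i < k)%:R * y i w 0 j); last first.
  apply/funext => w; rewrite /walk_sum summxE big_mkcond; apply: eq_bigr => i _.
  by case: ifP; rewrite ?mul1r ?mul0r.
by apply: measurable_sum => i; apply: measurable_funM.
Qed.

End Counting.

Section LawTransfer.
Variables (R : realType) (n d : nat).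

Lemma borel_coord (i : 'I_n) (j : 'I_d) :
  measurable_fun setT (fun M : g_sigma_algebraType (@mx_cyl R n d) => (M : 'M[R]_(n, d)) i j).
Proof.
move=> _ A mA; rewrite setTI; apply: sub_sigma_algebra.
by exists i, j, A.
Qed.

Lemma borel_not_conv m (v : 'I_m -> 'M[R]_(n, d) -> 'rV[R]_d) :
  (forall i j, measurable_fun setT (fun M : g_sigma_algebraType (@mx_cyl R n d) => v i M 0 j)) ->
  mx_borel [set M | ~ zero_in_conv (v^~ M)].
Proof. exact: (@measurable_not_conv R _ (g_sigma_algebraType (@mx_cyl R n d)) d m v). Qed.

Lemma borel_any_indep m (v : 'I_m -> 'M[R]_(n, d) -> 'rV[R]_d) :
  (forall i j, measurable_fun setT (fun M : g_sigma_algebraType (@mx_cyl R n d) => v i M 0 j)) ->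
  mx_borel [set M | any_d_indep (v^~ M)].
Proof. exact: (@measurable_any_indep R _ (g_sigma_algebraType (@mx_cyl R n d)) d m v). Qed.

Lemma borel_walk k j : measurable_fun setT
  (fun M : g_sigma_algebraType (@mx_cyl R n d) => walk_sum (fun i => row i (M : 'M[R]_(n, d))) k 0 j).
Proof.
apply: (measurable_walk (y := fun i (M : g_sigma_algebraType (@mx_cyl R n d)) => row i (M : 'M[R]_(n, d)))) => i l.
by under eq_fun do rewrite mxE; exact: borel_coord.
Qed.

(** General position is assumed for the given tuple; equality of laws carries it to every
    rearrangement because the exceptional set is Borel. *)
Lemma ae_same_law (dsp : measure_display) (T : measurableType dsp) (P : probability T R)
    (X Y : T -> 'M[R]_(n, d)) (B : set 'M[R]_(n, d)) :
  rand_mx X -> rand_mx Y -> same_law P X Y -> mx_borel B ->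
  {ae P, forall w, B (X w)} -> {ae P, forall w, B (Y w)}.
Proof.
move=> rX rY XY mB; have mCB : mx_borel (~` B) by exact: sigma_algebraC.
move=> h.
have hX : P (X @^-1` (~` B)) = 0%E by apply/negligibleP; [exact: rX|exact: h].
have hY : P.-negligible (Y @^-1` (~` B)) by apply/negligibleP; [exact: rY|exact: (etrans (esym (XY _ mCB)) hX)].
exact: hY.
Qed.

End LawTransfer.

(** * Averaging over the group *)

Section MeanCount.
Variables (R : realType) (dsp : measure_display) (T : measurableType dsp) (P : probability T R).
Variables (n d : nat) (xi : 'I_n -> T -> 'rV[R]_d) (b : bool) (m : nat).
Hypotheses (rxi : forall i, rand_mx (xi i)) (mE : m = (n - ~~ b)%N).
Hypotheses (d0 : (0 < d)%N) (dn : (d + ~~ b <= n)%N).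

Definition not_hull c := [set w | ~ zero_in_conv (@walk_fam R d n m (act_codes (xi^~ w) c))].

Lemma measurable_not_hull c : measurable (not_hull c).
Proof.
apply: (@measurable_not_conv _ _ _ d m (fun i w => @walk_fam R d n m (act_codes (xi^~ w) c) i)) => i j.
apply: (measurable_walk (y := fun i w => act_codes (xi^~ w) c i)) => k l.
rewrite /act_codes /act_code; case: (nth _ c k) => -[] i' /=; last exact: measurable_xi.
rewrite (_ : (fun w => _) = fun w => -1 * xi i' w 0 l); last by apply/funext => w; rewrite mxE mulN1r.
by apply: measurable_funM => //; exact: measurable_xi.
Qed.

Lemma sum_prob_not_hull :
  (forall c, c \in codes n b -> {ae P, forall w, any_d_indep (@walk_fam R d n m (act_codes (xi^~ w) c))}) ->
  b \/ {ae P, forall w, \sum_i xi i w = 0} ->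
  \sum_(c <- codes n b) fine (P (not_hull c)) = (sp_total b n - nmeet b n d)%:R.
Proof.
move=> gen bS; apply: sum_prob_indic; first exact: measurable_not_hull.
(* The count at w needs all rearrangements in general position at once; there are finitely many. *)
have aegen : {ae P, forall w, forall c, c \in codes n b -> any_d_indep (@walk_fam R d n m (act_codes (xi^~ w) c))}.
  elim: (codes n b) gen => [|c C IH] gen; first by apply: nearW => w c.
  have h1 := gen c (mem_head _ _).
  have h2 := IH (fun c' cC => gen c' (mem_behead (cC : c' \in behead (c :: C)))).
  apply: filterS2 h1 h2 => w h1 h2 c'; rewrite inE => /orP[/eqP ->|] //; exact: h2.
have aeS : {ae P, forall w, b || (\sum_i xi i w == 0)}.
  case: bS => [hb|]; first by apply: nearW => w; rewrite hb.
  by apply: filterS => w ->; rewrite eqxx orbT.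
apply: filterS2 aegen aeS => w gw Sw.
have m0 : (0 < m)%N by rewrite mE; lia.
have dm : (d <= m)%N by rewrite mE; lia.
have sumc c : c \in codes n b -> b || (\sum_i act_codes (xi^~ w) c i == 0).
  move=> cC; case: (boolP b) Sw => //= hb /eqP S0.
  have [s [e [nE eb _]]] := codesP cC; case: eb => [e0|]; last by rewrite (negbTE hb).
  rewrite (reindex_inj (@perm_inj _ s)) /= in S0; apply/eqP; rewrite -[RHS]S0.
  by apply: eq_bigr => i _; rewrite /act_codes nE e0 /act_code.
have key c : c \in codes n b -> `[< ~ zero_in_conv (@walk_fam R d n m (act_codes (xi^~ w) c)) >] =
    ~~ `[< chamber_meets b 0%VS [seq act_codes (xi^~ w) c i | i <- enum 'I_n] >].
  move=> cC; rewrite asbool_neg; congr (~~ _); apply: asbool_equiv_eq.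
  by apply: zero_in_conv_chamber => //; [exact: gw|exact: sumc].
have cnt : (\sum_(c <- codes n b) `[< chamber_meets b 0%VS [seq act_codes (xi^~ w) c i | i <- enum 'I_n] >] = nmeet b n d)%N.
  have h := @sum_chamber_meets R 'rV[R]_d b 0%VS [seq xi i w | i <- enum 'I_n] d.
  rewrite sp_steps size_map -cardE card_ord in h; rewrite -h => [|||//|//]; first by rewrite big_map.
  - by rewrite big_map big_enum /= memv0.
  - by move=> _ /mapP[c cC ->]; apply: generic_steps mE _; exact: gw.
  - by rewrite dimv0 addn0 dimvf /dim /= mul1n.
apply/eqP; rewrite -(eqn_add2r (nmeet b n d)) subnK; last first.
  by rewrite -cnt -size_all_codes -sum1_size leq_sum // => c _; case: asbool.
rewrite -{1}cnt -big_split /= -size_all_codes -sum1_size; apply/eqP.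
by apply: eq_big_seq => c cC; rewrite /not_hull /= key //; case: asbool.
Qed.

End MeanCount.

Lemma nmeet_le b n d : (nmeet b n d <= sp_total b n)%N.
Proof.
elim: n d => [|n IH] [|d] //=; case: ifP => // _.
by rewrite mulSn leq_add // leq_mul2l IH orbT.
Qed.

Section TypesAB.
Variables (R : realType) (dsp : measure_display) (T : measurableType dsp) (P : probability T R).
Variables (n d : nat) (xi : 'I_n -> T -> 'rV[R]_d).

Lemma prob_exchangeable b m : m = (n - ~~ b)%N -> (0 < d)%N -> (d + ~~ b <= n)%N ->
  (forall i, rand_mx (xi i)) ->
  (forall (s : 'S_n) (e : 'I_n -> bool), (e =1 fun=> false) \/ b -> same_law P (tup xi) (tup_ps xi s e)) ->
  b \/ {ae P, forall w, \sum_i xi i w = 0} ->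
  {ae P, forall w, any_d_indep (@walk_fam R d n m (xi^~ w))} ->
  fine (P [set w | ~ zero_in_conv (@walk_fam R d n m (xi^~ w))]) = hull_free R b n d.
Proof.
move=> mE d0 dn rxi law bS gen.
have tupE w : (fun i => row i (tup xi w)) = xi^~ w.
  by apply/funext => i; apply/rowP => j; rewrite !mxE.
have bw k j : measurable_fun setT (fun M : g_sigma_algebraType (@mx_cyl R n d) =>
   @walk_fam R d n m (fun i => row i (M : 'M[R]_(n, d))) k 0 j) by exact: borel_walk.
have genc c : c \in codes n b -> {ae P, forall w, any_d_indep (@walk_fam R d n m (act_codes (xi^~ w) c))}.
  move=> /codesP[s [e [nE eb _]]].
  have := ae_same_law (rand_tup rxi) (rand_tup_ps rxi s e) (law s e eb)
     (borel_any_indep (v := fun k M => @walk_fam R d n m (fun i => row i M) k) bw).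
  move=> h; have {}h := h _; apply: filterS (h _) => [w /=|].
    by rewrite (act_codes_ps xi w nE).
  by apply: filterS gen => w /=; rewrite tupE.
have := sum_prob_not_hull rxi mE d0 dn genc bS.
rewrite (eq_big_seq (fun=> fine (P [set w | ~ zero_in_conv (@walk_fam R d n m (xi^~ w))]))); last first.
  move=> c /codesP[s [e [nE eb _]]]; congr fine.
  have := law s e eb _ (borel_not_conv (v := fun k M => @walk_fam R d n m (fun i => row i M) k) bw).
  rewrite (_ : _ @^-1` _ = [set w | ~ zero_in_conv (@walk_fam R d n m (xi^~ w))]); last first.
    by apply/seteqP; split=> w /=; rewrite tupE.
  move=> ->; congr (P _); apply/seteqP; split=> w; rewrite /not_hull /= (act_codes_ps xi w nE) //.
rewrite big_const_seq count_predT size_all_codes iter_addr addr0 natrB ?nmeet_le //.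
have t0 : ((sp_total b n)%:R : R) != 0 by rewrite pnatr_eq0 -lt0n sp_total_gt0.
move=> h; rewrite /hull_free -[LHS](mulfK t0) mulr_natr h.
by rewrite mulrBl divff.
Qed.

End TypesAB.

(** * Convex hulls with two alternative end points *)

Section StarHull.
Variables (R : realType) (d : nat).

Lemma widen_lift k (i : 'I_k) : widen_ord (leqnSn k) i = lift ord_max i.
Proof. by apply: val_inj; rewrite /= /bump leqNgt ltn_ord. Qed.

Lemma zero_in_conv_scale m (v : 'I_m -> 'rV[R]_d) (a : 'I_m -> R) :
  (forall i, 0 <= a i) -> 0 < \sum_i a i -> \sum_i a i *: v i = 0 -> zero_in_conv v.
Proof.
move=> a0 sa av; exists (fun i => (\sum_i a i)^-1 * a i); split=> [i|].
  by rewrite mulr_ge0 // invr_ge0 ltW.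
split; first by rewrite -mulr_sumr mulVf // gt_eqF.
by under eq_bigr do rewrite -scalerA; rewrite -scaler_sumr av scaler0.
Qed.

Lemma zero_in_conv_recr m (v : 'I_m.+1 -> 'rV[R]_d) : zero_in_conv v <->
  exists (a : 'I_m -> R) (al : R), [/\ forall i, 0 <= a i, 0 <= al, \sum_i a i + al = 1 &
    \sum_i a i *: v (lift ord_max i) + al *: v ord_max = 0].
Proof.
split=> [[lam [lam0 [lam1 lamv]]]|[a [al [a0 al0 a1 av]]]].
  exists (fun i => lam (lift ord_max i)), (lam ord_max); split=> //.
    by rewrite -lam1 big_ord_recr /=; congr (_ + _); apply: eq_bigr => i _; rewrite widen_lift.
  by rewrite -[RHS]lamv big_ord_recr /=; congr (_ + _); apply: eq_bigr => i _; rewrite widen_lift.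
exists (fun i => if unlift ord_max i is Some j then a j else al); split=> [i|].
  by case: unliftP.
split.
  rewrite big_ord_recr /= unlift_none -[RHS]a1; congr (_ + _).
  by apply: eq_bigr => i _; rewrite widen_lift liftK.
rewrite big_ord_recr /= unlift_none -[RHS]av; congr (_ + _).
by apply: eq_bigr => i _; rewrite widen_lift liftK.
Qed.

Variables (k : nat) (u : 'I_k.+1 -> 'rV[R]_d) (A B : 'rV[R]_d).
Hypothesis AB : A + B = u ord_max + u ord_max.

Definition fam_ext m (v : 'I_m -> 'rV[R]_d) (C : 'rV[R]_d) (i : 'I_m.+1) :=
  if unlift ord_max i is Some j then v j else C.

Lemma fam_ext_conv m (v : 'I_m -> 'rV[R]_d) C : zero_in_conv (fam_ext v C) <->
  exists (a : 'I_m -> R) (al : R), [/\ forall i, 0 <= a i, 0 <= al, \sum_i a i + al = 1 &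
    \sum_i a i *: v i + al *: C = 0].
Proof.
rewrite zero_in_conv_recr /fam_ext unlift_none.
by split=> -[a [al [h1 h2 h3 h4]]]; exists a, al; split=> //; rewrite -[RHS]h4;
  congr (_ + _); apply: eq_bigr => i _; rewrite liftK.
Qed.

Lemma sum_delta (c : R) : \sum_(i < k.+1) (i == ord_max)%:R * c = c.
Proof.
rewrite (bigD1 ord_max) //= eqxx mul1r big1 ?addr0 // => i ne.
by rewrite (negbTE ne) mul0r.
Qed.

Lemma sum_delta_vec (c : R) : \sum_(i < k.+1) ((i == ord_max)%:R * c) *: u i = c *: u ord_max.
Proof.
rewrite (bigD1 ord_max) //= eqxx mul1r big1 ?addr0 // => i ne.
by rewrite (negbTE ne) mul0r scale0r.
Qed.

(** The smaller weight [be] is removed from C and D together and given twice to their midpoint, the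
    last vector of u. *)
Lemma star_reduce C D (a : 'I_k.+1 -> R) (al be : R) : C + D = u ord_max + u ord_max ->
  (forall i, 0 <= a i) -> 0 <= be -> be <= al -> \sum_i a i + al + be = 1 ->
  \sum_i a i *: u i + al *: C + be *: D = 0 -> zero_in_conv (fam_ext u C).
Proof.
move=> CD a0 be0 ab s1 av; apply/fam_ext_conv.
exists (fun i => a i + (i == ord_max)%:R * (2 * be)), (al - be); split=> [i||  |].
- by rewrite addr_ge0 // mulr_ge0 ?ler0n // mulr_ge0.
- by rewrite subr_ge0.
- by rewrite big_split /= sum_delta -[RHS]s1; ring.
under eq_bigr do rewrite scalerDl.
rewrite big_split /= sum_delta_vec -[RHS]av -!addrA; congr (_ + _).
have -> : D = u ord_max + u ord_max - C by rewrite -CD addrC addKr.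
rewrite scalerBl scalerBr scalerDr mulrDl mul1r scalerDl addrC.
by rewrite -!addrA; congr (_ + _); rewrite addrC -!addrA.
Qed.

Lemma star_hull : zero_in_conv (fam_ext (fam_ext u A) B) <->
  zero_in_conv (fam_ext u A) \/ zero_in_conv (fam_ext u B).
Proof.
split=> [/fam_ext_conv[a [be [a0 be0 s1 av]]]|[]].
- have sE (V : lmodType R) (v : V) (w : 'I_k.+1 -> V) : \sum_i a i *: (fam_ext u A i) = \sum_i a (lift ord_max i) *: u i + a ord_max *: A.
    rewrite big_ord_recr /= /fam_ext unlift_none; congr (_ + _).
    by apply: eq_bigr => i _; rewrite widen_lift liftK.
  rewrite (sE R^o 0 (fun=> 0)) in av.
  have s1' : \sum_i a (lift ord_max i) + a ord_max + be = 1.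
    rewrite -[RHS]s1 [in RHS]big_ord_recr /=; congr (_ + _ + _).
    by apply: eq_bigr => i _; rewrite widen_lift.
  have [ba|ab] := leP be (a ord_max).
    by left; apply: (star_reduce AB _ be0 ba s1' av) => i.
  right; apply: (@star_reduce B A (fun i => a (lift ord_max i)) be (a ord_max)) => //.
  + by rewrite addrC.
  + exact: ltW.
  + by rewrite addrAC.
  + by rewrite addrAC.
- move=> /fam_ext_conv[a [al [a0 al0 s1 av]]]; apply/fam_ext_conv.
  exists (fun i => if unlift ord_max i is Some j then a j else al), 0; split=> //.
  + by move=> i; case: unliftP.
  + rewrite addr0 big_ord_recr /= unlift_none -[RHS]s1; congr (_ + _).
    by apply: eq_bigr => i _; rewrite widen_lift liftK.
  + rewrite scale0r addr0 big_ord_recr /= /fam_ext unlift_none -[RHS]av; congr (_ + _).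
    by apply: eq_bigr => i _; rewrite widen_lift liftK.
- move=> /fam_ext_conv[a [al [a0 al0 s1 av]]]; apply/fam_ext_conv.
  exists (fun i => if unlift ord_max i is Some j then a j else 0), al; split=> //.
  + by move=> i; case: unliftP.
  + rewrite big_ord_recr /= unlift_none addr0 -[RHS]s1; congr (_ + _).
    by apply: eq_bigr => i _; rewrite widen_lift liftK.
  + rewrite big_ord_recr /= /fam_ext unlift_none scale0r addr0 -[RHS]av; congr (_ + _).
    by apply: eq_bigr => i _; rewrite widen_lift liftK.
Qed.

(** General position makes the weights of A and of B positive. Cross-multiplying equalises them, and
    A + B becomes twice the last vector of u. *)
Lemma star_both : (d <= k.+2)%N -> any_d_indep (fam_ext u A) -> any_d_indep (fam_ext u B) ->
  zero_in_conv u <-> zero_in_conv (fam_ext u A) /\ zero_in_conv (fam_ext u B).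
Proof.
move=> dk iA iB; split=> [[a [a0 [a1 av]]]|[zA zB]].
  by split; apply/fam_ext_conv; exists a, 0; split; rewrite ?addr0 // scale0r addr0.
have [mu [mu0 muv]] := zero_in_conv_pos dk iA zA.
have [nu [nu0 nuv]] := zero_in_conv_pos dk iB zB.
have recr (C : 'rV[R]_d) (l : 'I_k.+2 -> R) : \sum_i l i *: fam_ext u C i =
    \sum_i l (lift ord_max i) *: u i + l ord_max *: C.
  rewrite big_ord_recr /= /fam_ext unlift_none; congr (_ + _).
  by apply: eq_bigr => i _; rewrite widen_lift liftK.
rewrite !recr in muv nuv.
set al := mu ord_max in muv; set be := nu ord_max in nuv.
have al0 : 0 < al := mu0 _; have be0 : 0 < be := nu0 _.
pose a i := be * mu (lift ord_max i) + al * nu (lift ord_max i) + (i == ord_max)%:R * (2 * (al * be)).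
have a0 i : 0 < a i.
  rewrite /a ltr_pwDl ?addr_gt0 ?mulr_gt0 // mulr_ge0 ?ler0n //.
  by rewrite mulr_ge0 // ltW // mulr_gt0.
apply: (@zero_in_conv_scale _ _ a) => [i||]; first exact: ltW.
  by rewrite (bigD1 ord0) //= ltr_pwDl // sumr_ge0 // => i _; rewrite ltW.
rewrite /a; under eq_bigr do rewrite !scalerDl -!scalerA.
rewrite !big_split /= -!scaler_sumr.
have -> : \sum_i (i == ord_max)%:R *: (2 *: (al *: (be *: u i))) = (2 * (al * be)) *: u ord_max.
  by rewrite -sum_delta_vec; apply: eq_bigr => i _; rewrite !scalerA; congr (_ *: _); ring.
have -> : \sum_i mu (lift ord_max i) *: u i = - (al *: A) by apply/eqP; rewrite -addr_eq0 muv.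
have -> : \sum_i nu (lift ord_max i) *: u i = - (be *: B) by apply/eqP; rewrite -addr_eq0 nuv.
rewrite !scalerN !scalerA (mulrC be) -opprD -scalerDr AB mulrDl mul1r scalerDl scalerDr.
by rewrite addNr.
Qed.

End StarHull.

(** * Even and odd signed permutations *)

Section Parity.
Variable n : nat.

Definition code_parity (c : seq (signed_index n)) := odd (\sum_(x <- c) x.1).

Lemma parity_cons x (c : seq (signed_index n)) : code_parity (x :: c) = x.1 (+) code_parity c.
Proof. by rewrite /code_parity big_cons oddD oddb. Qed.

(** In every slot x and its opposite give opposite parities, whatever y is; so exactly half of the
    codes are even. *)
Lemma sum_ins_parity x y (f : bool -> nat) :
  (\sum_(z <- ins true (@code_neg n) x y) f (code_parity z) = (size y).+1 * (f false + f true))%N.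
Proof.
elim: y f => [|a y IH] f.
  rewrite sum_ins_nil !mul1n !parity_cons /code_parity !big_nil /=.
  by case: x => -[] i /=; lia.
rewrite sum_ins_cons !parity_cons mul1n /=.
have -> : (\sum_(z <- ins true (@code_neg n) x y) f (code_parity (a :: z)) =
  (size y).+1 * (f (a.1 (+) false) + f (a.1 (+) true)))%N.
  by rewrite -(IH (fun p => f (a.1 (+) p))); apply: eq_bigr => z _; rewrite parity_cons.
rewrite mulSn; congr (_ + _)%N.
  by move: (a.1 (+) _) => p; case: (x.1); case: p => //=; exact: addnC.
by case: (a.1) => //=; rewrite (addnC (f true)).
Qed.

Lemma sum_sp_parity x s (f : bool -> nat) :
  (\sum_(c <- sp true (@code_neg n) (x :: s)) f (code_parity c) =
   (size s).+1 * sp_total true (size s) * (f false + f true))%N.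
Proof.
rewrite sum_sp_cons; under eq_bigr do rewrite sum_ins_parity.
rewrite (eq_big_seq (fun=> (size s).+1 * (f false + f true))%N) => [|y /sp_size -> //].
by rewrite big_const_seq count_predT iter_addn_0 size_sp mulnAC.
Qed.

End Parity.

(** * The walk with reversed last step *)

Section StarWalk.
Variables (R : realType) (d k : nat).
Implicit Types y : 'I_k.+2 -> 'rV[R]_d.

Definition short_fam y (i : 'I_k.+1) := walk_sum y i.+1.
Definition star_sum y := walk_sum y k.+1 - y ord_max.
Definition star_fam y := fam_ext (short_fam y) (star_sum y).

Lemma walk_sum_last y : walk_sum y k.+2 = walk_sum y k.+1 + y ord_max.
Proof.
rewrite /walk_sum (bigD1 ord_max) //= addrC; congr (_ + _); apply: eq_bigl => i.
by rewrite -val_eqE /= ltn_ord; have := ltn_ord i; lia.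
Qed.

Lemma star_sumD y : walk_sum y k.+2 + star_sum y = short_fam y ord_max + short_fam y ord_max.
Proof. by rewrite /star_sum /short_fam walk_sum_last /= addrACA subrr addr0. Qed.

Lemma lift_max_val m (j : 'I_m) : lift ord_max j = j :> nat.
Proof. by rewrite -widen_lift. Qed.

Lemma walk_fam_ext y : @walk_fam R d k.+2 k.+2 y = fam_ext (short_fam y) (walk_sum y k.+2).
Proof.
apply/funext => i; rewrite /walk_fam /fam_ext; case: unliftP => [j ->|-> //].
by rewrite lift_max_val.
Qed.

Lemma short_fam_walk y : short_fam y = @walk_fam R d k.+1 k.+1 (fun i => y (lift ord_max i)).
Proof.
apply/funext => i; rewrite /short_fam /walk_fam /walk_sum big_mkcond big_ord_recr /=.
rewrite ltnS leqNgt (ltn_ord i) addr0 [RHS]big_mkcond; apply: eq_bigr => j _.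
by rewrite widen_lift.
Qed.

(** Reversing the last step exchanges the two end points and keeps all earlier sums. *)
Lemma star_fam_flip y y' : (forall j, y' (lift ord_max j) = y (lift ord_max j)) ->
  y' ord_max = - y ord_max -> star_fam y' = @walk_fam R d k.+2 k.+2 y.
Proof.
move=> h hm; have ws m : (m <= k.+1)%N -> walk_sum y' m = walk_sum y m.
  move=> mk; apply: eq_bigr => i im; case: (unliftP ord_max i) im => [j -> _ //|-> /=].
  by rewrite ltnNge mk.
rewrite walk_fam_ext /star_fam /star_sum ws // hm opprK -walk_sum_last.
by congr fam_ext; apply/funext => i; rewrite /short_fam ws // ltn_ord.
Qed.

Lemma measurable_star (dsp : measure_display) (S : measurableType dsp) (y : 'I_k.+2 -> S -> 'rV[R]_d) i j :
  (forall i j, measurable_fun setT (fun w => y i w 0 j)) ->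
  measurable_fun setT (fun w => star_fam (y^~ w) i 0 j).
Proof.
move=> my; rewrite /star_fam /fam_ext; case: (unlift ord_max i) => [l|]; first exact: measurable_walk.
rewrite (_ : (fun w => _) = fun w => walk_sum (y^~ w) k.+1 0 j + -1 * y ord_max w 0 j); last first.
  by apply/funext => w; rewrite /star_sum !mxE mulN1r.
apply: measurable_funD; first exact: measurable_walk.
by apply: measurable_funM.
Qed.

End StarWalk.

(** * Type D from type B *)

Section TypeD.
Variables (R : realType) (dsp : measure_display) (T : measurableType dsp) (P : probability T R).
Variables (k d : nat) (xi : 'I_k.+2 -> T -> 'rV[R]_d).
Hypotheses (rxi : forall i, rand_mx (xi i)) (d0 : (0 < d)%N) (dk : (d <= k.+1)%N).
Hypothesis law : forall (s : 'S_k.+2) (e : 'I_k.+2 -> bool),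
  \prod_(i < k.+2) ((-1) ^+ e i : R) = 1 -> same_law P (tup xi) (tup_ps xi s e).
Hypothesis genA : {ae P, forall w, any_d_indep (@walk_fam R d k.+2 k.+2 (xi^~ w))}.
Hypothesis genB : {ae P, forall w, any_d_indep (star_fam (xi^~ w))}.

Local Notation MT n := (g_sigma_algebraType (@mx_cyl R n d)).
Let NA := [set w | ~ zero_in_conv (@walk_fam R d k.+2 k.+2 (xi^~ w))].
Let NB := [set w | ~ zero_in_conv (star_fam (xi^~ w))].
Let NC := [set w | ~ zero_in_conv (short_fam (xi^~ w))].
Let ND := [set w | ~ zero_in_conv (fam_ext (@walk_fam R d k.+2 k.+2 (xi^~ w)) (star_sum (xi^~ w)))].

Let tupE w : (fun i => row i (tup xi w)) = xi^~ w.
Proof. by apply/funext => i; apply/rowP => j; rewrite !mxE. Qed.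

Let mxi := measurable_xi rxi.

Let mNA : measurable NA.
Proof.
by apply: (measurable_not_conv (v := fun i w => @walk_fam R d k.+2 k.+2 (xi^~ w) i)) => i j; exact: measurable_walk.
Qed.
Let mNB : measurable NB.
Proof.
by apply: (measurable_not_conv (v := fun i w => star_fam (xi^~ w) i)) => i j; exact: measurable_star.
Qed.
Let mNC : measurable NC.
Proof.
by apply: (measurable_not_conv (v := fun i w => short_fam (xi^~ w) i)) => i j; exact: measurable_walk.
Qed.
Let NDE : ND = NA `&` NB.
Proof.
apply/seteqP; split=> w; rewrite /ND /NA /NB /= walk_fam_ext (star_hull (star_sumD _)).
  by move=> h; split=> hh; apply: h; [left|right].
by move=> [h1 h2] [|].
Qed.

Let prob_complement (A : set T) : measurable A -> fine (P A) + fine (P (~` A)) = 1.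
Proof.
move=> mA; rewrite probability_setC // fineB ?fin_num_measure //=; ring.
Qed.

Lemma inclusion_exclusion_D : fine (P ND) + fine (P NC) = fine (P NA) + fine (P NB).
Proof.
have mND : measurable ND by rewrite NDE; exact: measurableI.
(* ND is the intersection of NA and NB, and NC is almost surely their union, so exactly two of these
   four events occur: inclusion-exclusion as a constant count. *)
pose A i := nth set0 [:: ND; NC; ~` NA; ~` NB] i.
have mA i : measurable (A i).
  case: i => [|[|[|[|i]]]]; rewrite /A /=; [exact: mND|exact: mNC|exact: measurableC|exact: measurableC|].
  by rewrite nth_nil; exact: measurable0.
have : \sum_(c <- [:: 0; 1; 2; 3]%N) fine (P (A c)) = 2%:R.
  apply: sum_prob_indic mA _.
  apply: filterS2 genA genB => w gA gB.
  rewrite !big_cons big_nil /A /= NDE.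
  have := star_both (star_sumD (xi^~ w)) (leqW dk).
  rewrite -walk_fam_ext => /(_ gA gB) both.
  have -> : `[< NC w >] = `[< NA w >] || `[< NB w >].
    rewrite -asbool_or; apply: asbool_equiv_eq; rewrite /NC /NA /NB /= both -not_andE.
    by [].
  rewrite asbool_and !asbool_neg.
  by do 2 case: (`[< zero_in_conv _ >]).
rewrite !big_cons big_nil /A /=.
have := prob_complement mNA; have := prob_complement mNB; lra.
Qed.

(** The first k + 1 steps form a type B tuple: any signs on them extend to a choice with product 1
    through the sign of the last step. *)
Lemma prob_short : fine (P NC) = hull_free R true k.+1 d.
Proof.
pose xs (i : 'I_k.+1) := xi (lift ord_max i).
rewrite -(@prob_exchangeable R _ T P k.+1 d xs true k.+1); first last.
- apply: filterS genA => w gA.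
  have -> : @walk_fam R d k.+1 k.+1 (xs^~ w) = short_fam (xi^~ w) by rewrite short_fam_walk.
  move=> f fi; have fi' : injective (fun i => lift ord_max (f i)) by move=> i j /lift_inj /fi.
  rewrite -(_ : \matrix_(i < d) @walk_fam R d k.+2 k.+2 (xi^~ w) (lift ord_max (f i)) = \matrix_(i < d) _).
    exact: (gA _ fi').
  by apply/matrixP => i j; rewrite !mxE walk_fam_ext /fam_ext liftK.
- by left.
- move=> s e _ B mB.
  pose restr (M : 'M[R]_(k.+2, d)) : 'M[R]_(k.+1, d) := \matrix_(i, j) M (lift ord_max i) j.
  have mr : mx_borel (restr @^-1` B).
    apply: (@coord_rand_mx R _ (MT k.+2) k.+1 d restr) => // i j.
    by under eq_fun do rewrite mxE; exact: borel_coord.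
  pose e' i := if unlift ord_max i is Some j then e j else odd (\sum_i e i)%N.
  have pe : \prod_(i < k.+2) ((-1) ^+ e' i : R) = 1.
    rewrite big_ord_recr /= {2}/e' unlift_none.
    rewrite (eq_bigr (fun i => (-1) ^+ e i)); last by move=> i _; rewrite widen_lift /e' liftK.
    by rewrite prodrXr signr_odd -exprD addnn -mul2n exprM sqrrN !expr1n.
  have h := @law (lift_perm ord_max ord_max s) e' pe _ mr.
  have tE : restr \o tup xi = tup xs by apply/funext => w; apply/matrixP => i j; rewrite !mxE.
  have tpE : restr \o tup_ps xi (lift_perm ord_max ord_max s) e' = tup_ps xs s e.
    by apply/funext => w; apply/matrixP => i j; rewrite !mxE lift_perm_lift /e' liftK.
  by rewrite -tE -tpE; exact: h.
- by move=> i; exact: rxi.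
- by rewrite addn0.
- exact: d0.
- by rewrite subn0.
by congr (fine (P _)); apply/seteqP; split=> w; rewrite /NC /= short_fam_walk.
Qed.

(** An odd code becomes even when the last sign is flipped, at the price of replacing the walk by
    its star version. *)
Lemma code_cases c : c \in codes k.+2 true ->
  exists (s : 'S_k.+2) (e : 'I_k.+2 -> bool),
   \prod_(i < k.+2) ((-1) ^+ e i : R) = 1 /\
   forall w, @walk_fam R d k.+2 k.+2 (act_codes (xi^~ w) c) =
     (if code_parity c then star_fam (fun i => row i (tup_ps xi s e w))
      else @walk_fam R d k.+2 k.+2 (fun i => row i (tup_ps xi s e w))).
Proof.
move=> /codesP[s [e [nE _ cE]]].
have pE : \prod_(i < k.+2) ((-1) ^+ e i : R) = (-1) ^+ code_parity c.
  by rewrite prodrXr -[LHS]signr_odd /code_parity cE big_map big_enum.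
case: (boolP (code_parity c)) => par; last first.
  exists s, e; rewrite pE (negbTE par); split=> // w.
  by rewrite (act_codes_ps xi w nE).
exists s, (fun i => e i (+) (i == ord_max)); split=> [|w].
  rewrite big_ord_recr /= eqxx addbT.
  rewrite (eq_bigr (fun i => (-1) ^+ e (widen_ord (leqnSn k.+1) i))); last first.
    by move=> i _; rewrite widen_lift eq_sym (negbTE (neq_lift _ _)) addbF.
  move: pE; rewrite big_ord_recr par /= expr1.
  by case: (e ord_max); rewrite /= ?expr1 ?expr0 ?mulrN1 ?mulr1 => h; lra.
rewrite -(act_codes_ps xi w nE); apply/esym/star_fam_flip => [j|]; apply/rowP => l; rewrite !mxE.
  by rewrite [_ == ord_max]eq_sym (negbTE (neq_lift _ _)) addbF.
by rewrite eqxx addbT; case: (e ord_max); rewrite /= ?expr1 ?expr0 ?mulN1r ?mul1r ?opprK.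
Qed.

(** The pointwise type B count runs over all codes. By type D invariance every even code has the
    probability of NA and every odd one that of NB, and both classes have the same size. *)
Lemma sum_prob_AB : fine (P NA) + fine (P NB) = 2 * hull_free R true k.+2 d.
Proof.
have bwA i j : measurable_fun setT (fun M : MT k.+2 => @walk_fam R d k.+2 k.+2 (fun i => row i (M : 'M[R]_(k.+2, d))) i 0 j).
  exact: borel_walk.
have bwB i j : measurable_fun setT (fun M : MT k.+2 => star_fam (fun i => row i (M : 'M[R]_(k.+2, d))) i 0 j).
  apply: (measurable_star (y := fun i (M : MT k.+2) => row i (M : 'M[R]_(k.+2, d)))) => i' l.
  by under eq_fun do rewrite mxE; exact: borel_coord.
have gen c : c \in codes k.+2 true -> {ae P, forall w, any_d_indep (@walk_fam R d k.+2 k.+2 (act_codes (xi^~ w) c))}.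
  move=> /code_cases[s [e [e1 wE]]].
  have rt := rand_tup rxi; have rs := rand_tup_ps rxi s e.
  case: (code_parity c) wE => wE.
    have h := ae_same_law rt rs (@law s e e1) (borel_any_indep (v := fun i M => star_fam (fun i => row i M) i) bwB).
    apply: filterS (h _) => [w /=|]; first by rewrite wE.
    by apply: filterS genB => w /=; rewrite tupE.
  have h := ae_same_law rt rs (@law s e e1) (borel_any_indep (v := fun i M => @walk_fam R d k.+2 k.+2 (fun i => row i M) i) bwA).
  apply: filterS (h _) => [w /=|]; first by rewrite wE.
  by apply: filterS genA => w /=; rewrite tupE.
have mE : k.+2 = (k.+2 - ~~ true)%N by rewrite subn0.
have dn : (d + ~~ true <= k.+2)%N by rewrite addn0 leqW.
have tE : sp_total true k.+2 = (2 * (k.+2 * sp_total true k.+1))%N.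
  rewrite mulnA -[sp_total true k.+2]/((slots true k.+1).+1 * sp_total true k.+1)%N.
  by congr (_ * _)%N; rewrite /slots -mul2n; lia.
have tR : (sp_total true k.+2)%:R = 2 * (k.+2 * sp_total true k.+1)%:R :> R.
  by rewrite tE (natrM _ 2).
have := sum_prob_not_hull rxi mE d0 dn gen (or_introl isT).
rewrite natrB ?nmeet_le // /hull_free tR; move: ((nmeet true k.+2 d)%:R : R) => x.
pose v (p : bool) := if p then fine (P NB) else fine (P NA).
rewrite (eq_big_seq (fun c => v (code_parity c))); last first.
  move=> c /code_cases[s [e [e1 wE]]]; rewrite /v /not_hull; case: (code_parity c) wE => wE.
    have := @law s e e1 _ (borel_not_conv (v := fun i M => star_fam (fun i => row i M) i) bwB).
    rewrite (_ : _ @^-1` _ = NB); last by apply/seteqP; split=> w; rewrite /NB /= tupE.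
    by move=> ->; congr (fine (P _)); apply/seteqP; split=> w /=; rewrite wE.
  have := @law s e e1 _ (borel_not_conv (v := fun i M => @walk_fam R d k.+2 k.+2 (fun i => row i M) i) bwA).
  rewrite (_ : _ @^-1` _ = NA); last by apply/seteqP; split=> w; rewrite /NA /= tupE.
  by move=> ->; congr (fine (P _)); apply/seteqP; split=> w /=; rewrite wE.
have cnt p : (\sum_(c <- codes k.+2 true) (code_parity c == p) = k.+2 * sp_total true k.+1)%N.
  rewrite /codes enum_ordSl map_cons (sum_sp_parity _ _ (fun q => (q == p) : nat)).
  have -> : size [seq (false, i) | i <- [seq lift ord0 i | i <- enum 'I_k.+1]] = k.+1.
    by rewrite 2!size_map; first [exact: size_enum_ord|by rewrite -cardT card_ord].
  by case: p; exact: muln1.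
rewrite (eq_bigr (fun c => (code_parity c == false)%:R * v false + (code_parity c == true)%:R * v true)); last first.
  by move=> c _; case: (code_parity c); rewrite /= ?mul1r ?mul0r ?addr0 ?add0r.
rewrite big_split -!mulr_suml -!natr_sum !cnt.
have M0 : ((k.+2 * sp_total true k.+1)%:R : R) != 0.
  by rewrite pnatr_eq0 -lt0n muln_gt0 sp_total_gt0.
move: ((k.+2 * sp_total true k.+1)%:R : R) M0 => M M0 h.
have {}h : M * (fine (P NA) + fine (P NB)) = 2 * M - x by rewrite mulrDr; exact: h.
have -> : fine (P NA) + fine (P NB) = (2 * M - x) / M by rewrite -h mulrC mulKf.
by field.
Qed.

Lemma prob_typeD : fine (P ND) = 2 * hull_free R true k.+2 d - hull_free R true k.+1 d.
Proof. by have := inclusion_exclusion_D; rewrite prob_short sum_prob_AB; lra. Qed.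

End TypeD.

(** * Exact probabilities and the limit *)

Section Types.
Variables (R : realType) (dsp : measure_display) (T : measurableType dsp) (P : probability T R).
Variables (n d : nat) (xi : 'I_n -> T -> 'rV[R]_d).

Lemma prob_typeA : (0 < d)%N -> (d < n)%N -> hypA xi P ->
  fine (P (not_in_hull xi TypeA)) = hull_free R false n d.
Proof.
move=> d0 dn [rxi law S0 gen].
apply: (@prob_exchangeable R _ T P n d xi false n.-1) => //.
- by rewrite subn1.
- by rewrite addn1.
- by move=> s e [e0|//]; rewrite (_ : e = fun=> false) //; apply/funext.
- right; apply: filterS S0 => w Sw; rewrite -[RHS]Sw /Ssum.
  by apply: eq_bigl => i; rewrite ltn_ord.
Qed.

Lemma prob_typeB : (0 < d)%N -> (d <= n)%N -> hypB xi P ->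
  fine (P (not_in_hull xi TypeB)) = hull_free R true n d.
Proof.
move=> d0 dn [rxi law gen].
apply: (@prob_exchangeable R _ T P n d xi true n) => //.
- by rewrite subn0.
- by rewrite addn0.
- by left.
Qed.

End Types.

(** d < n is strict since the walk without its last step must still have at least d steps. *)
Lemma prob_hypD (R : realType) (dsp : measure_display) (T : measurableType dsp)
    (P : probability T R) n d (xi : 'I_n -> T -> 'rV[R]_d) :
  (1 < n)%N -> (0 < d)%N -> (d < n)%N -> hypD xi P ->
  fine (P (not_in_hull xi TypeD)) = 2 * hull_free R true n d - hull_free R true n.-1 d.
Proof.
case: n xi => [|[|k]] // xi _ d0 dk [rxi law genA genB].
have starE w : Sstar xi w = star_sum (xi^~ w).
  rewrite /Sstar /star_sum /=; congr (_ - _); apply: (big_pred1 ord_max) => i /=.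
  by rewrite -val_eqE.
have famDstarE w : famDstar xi w = star_fam (xi^~ w).
  apply/funext => i; rewrite /famDstar /star_fam /fam_ext; case: unliftP => [j ->|->].
    by rewrite lift_max_val /= ltn_ord.
  by rewrite /= ltnn starE.
have famDE w : famD xi w = fam_ext (@walk_fam R d k.+2 k.+2 (xi^~ w)) (star_sum (xi^~ w)).
  apply/funext => i; rewrite /famD /fam_ext; case: unliftP => [j ->|->].
    by rewrite lift_max_val ltn_ord.
  by rewrite /= ltnn starE.
have genB' : {ae P, forall w, any_d_indep (star_fam (xi^~ w))}.
  by apply: filterS genB => w; rewrite famDstarE.
rewrite -(prob_typeD rxi d0 _ law genA genB') //.
by congr (fine (P _)); apply/seteqP; split=> w /=; rewrite famDE.
Qed.

Theorem theorem5p1 (R : realType) (t : ctype) (d : nat) (hd : (2 <= d)%N)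
  (dsp : nat -> measure_display) (T : forall n, measurableType (dsp n))
  (P : forall n, probability (T n) R)
  (xi : forall n, 'I_n -> T n -> 'rV[R]_d)
  (H : forall n, size_ok t d n -> hyps (xi n) (P n) t) :
  (fun n : nat => fine (P n (not_in_hull (xi n) t)) / rate R t d n) @ \oo --> (1 : R).
Proof.
case: d hd xi H => [|d] // d1 xi; case: t => H.
- apply: (cvg_trans _ (@cvg_rateA R d)); apply: near_eq_cvg; near=> n.
  have nd : (d.+2 <= n)%N by near: n; exists d.+2.
  by rewrite (prob_typeA (ltn0Sn d) nd (H n nd)).
- apply: (cvg_trans _ (@cvg_rateB R d d1)); apply: near_eq_cvg; near=> n.
  have nd : (d.+1 <= n)%N by near: n; exists d.+1.
  by rewrite (prob_typeB (ltn0Sn d) nd (H n nd)).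
- apply: (cvg_trans _ (@cvg_rateD R d d1)); apply: near_eq_cvg; near=> n.
  have nd : (d.+2 <= n)%N by near: n; exists d.+2.
  have n2 : (2 <= n)%N by apply: leq_trans nd.
  have ok : size_ok TypeD d.+1 n by rewrite /size_ok geq_max n2 ltnW.
  by rewrite (prob_hypD n2 (ltn0Sn d) nd (H n ok)).
Unshelve. all: by end_near. Qed.
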